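(* Let $n\in\mathbb Z$, let $(p,q,c)$ lie on the surface $\Sigma_{N,n}$ defined by $(-p^{1/2})^n=q^{-c-N}$, and for $s=1,\dots,N-1$ let $$w_s(z)\equiv\mathrm{Tr}\left[\left(\prod_{1\le i\le s}\ \prod_{j>i}P_{ij}\right)\prod_{1\le i\le s}\left({\cal L}^{(n)}_i(z_i)\prod_{j>i}\widehat R^*_{ij}(q^{-N}z_i/z_j)^{t_it_j}\right)\right],\qquad z_i=zq^{\,i-\frac{s+1}2},$$ in ${\cal A}_{q,p}(\widehat{sl}(N)_c)$ (ordered products, conventions in the context). Setting $q^{Nh}=p^{1-\beta}$ for any integer $h\ne0$, the $h$-labeled Poisson structure defined by $$\{w_i(z),w_j(w)\}^{(h)}=\lim_{\beta\to0}\frac1\beta\big(w_i(z)\,w_j(w)-w_j(w)\,w_i(z)\big)$$ has the expression $$\{w_i(z),w_j(w)\}^{(h)}=\sum_{u=-(i-1)/2}^{(i-1)/2}\ \sum_{v=-(j-1)/2}^{(j-1)/2}f_h\Big(q^{v-u}\frac wz\Big)\,w_i(z)\,w_j(w)$$ ($u,v$ running in unit steps), where, for $h$ odd, $$\begin{aligned}f_h(x)=2Nh\ln q\Big[&\sum_{\ell\ge0}\Big\{E(\tfrac n2)\big(E(\tfrac n2)+1\big)\Big(\frac{2x^2q^{2N\ell}}{1-x^2q^{2N\ell}}-\frac{x^2q^{2N\ell+2}}{1-x^2q^{2N\ell+2}}-\frac{x^2q^{2N\ell-2}}{1-x^2q^{2N\ell-2}}\Big)\\&+E(\tfrac{n+1}2)^2\Big(\frac{2x^2q^{2N\ell+N}}{1-x^2q^{2N\ell+N}}-\frac{x^2q^{2N\ell+N+2}}{1-x^2q^{2N\ell+N+2}}-\frac{x^2q^{2N\ell+N-2}}{1-x^2q^{2N\ell+N-2}}\Big)\Big\}\\&-\frac12E(\tfrac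 n2)\big(E(\tfrac n2)+1\big)\Big(\frac{2x^2}{1-x^2}-\frac{x^2q^2}{1-x^2q^2}-\frac{x^2q^{-2}}{1-x^2q^{-2}}\Big)-(x\leftrightarrow x^{-1})\Big],\end{aligned}$$ and, for $h$ even, $$\begin{aligned}f_h(x)=Nh\,n(n+1)\ln q\Big[&\sum_{\ell\ge0}\Big(\frac{2x^2q^{2N\ell}}{1-x^2q^{2N\ell}}-\frac{x^2q^{2N\ell+2}}{1-x^2q^{2N\ell+2}}-\frac{x^2q^{2N\ell-2}}{1-x^2q^{2N\ell-2}}\Big)\\&-\frac12\Big(\frac{2x^2}{1-x^2}-\frac{x^2q^2}{1-x^2q^2}-\frac{x^2q^{-2}}{1-x^2q^{-2}}\Big)-(x\leftrightarrow x^{-1})\Big].\end{aligned}$$ Here $E(m)$ denotes the integer part of $m$, and $-(x\leftrightarrow x^{-1})$ means that one subtracts all the preceding terms inside the square bracket with $x$ replaced by $x^{-1}$.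
   Context: Parameters. $N\ge 2$ is an integer; $q,p,c$ are generic complex parameters for which the expressions below make sense (for the infinite products, when needed: $|q|<1$, $|p|<1$), with fixed logarithms so that fractional powers are defined. Put $p^*=pq^{-2c}$ and $(p^* )^{1/2}=p^{1/2}q^{-c}$. The integer part $E(m)$ is the floor (greatest integer $\le m$). Notation: $(x;a)_\infty=\prod_{m\ge0}(1-xa^m)$, $(x;a,b)_\infty=\prod_{m,l\ge0}(1-xa^mb^l)$, $\Theta_a(x)=(x;a)_\infty(ax^{-1};a)_\infty(a;a)_\infty$. $R$-matrix. Write $z=e^{i\pi\xi}$, $q=e^{i\pi\zeta}$, $p=e^{2i\pi\tau}$, $\omega=e^{2i\pi/N}$, $\vartheta\left[{\gamma_1\atop\gamma_2}\right](\xi,\tau)=\sum_{m\in\mathbb Z}\exp\big(i\pi(m+\gamma_1)^2\tau+2i\pi(m+\gamma_1)(\xi+\gamma_2)\big)$. Let $g$ and ${\sf h}$ be the $N\times N$ matrices $g_{ij}=\omega^i\delta_{ij}$, ${\sf h}_{ij}=\delta_{i+1,j}$ (indices mod $N$; the matrix ${\sf h}$ is not to be confused with the integer $h$), $I_{(\alpha_1,\alpha_2)}=g^{\alpha_2}{\sf h}^{\alpha_1}$, $g^{1/2}$ a fixed diagonal square root of $g$, $a=g^{1/2}{\sf h}g^{1/2}$, and $$W_{(\alpha_1,\alpha_2)}(\xi,\zeta,\tau)=\frac1N\,\frac{\vartheta\left[{1/2+\alpha_1/N\atop 1/2+\alpha_2/N}\right](\xi+\zeta/N,\tau)}{\vartheta\left[{1/2+\alpha_1/N\atop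 1/2+\alpha_2/N}\right](\zeta/N,\tau)},$$ $$\frac1{\kappa(z^2)}=\frac{(q^{2N}z^{-2};p,q^{2N})_\infty(q^2z^2;p,q^{2N})_\infty(pz^{-2};p,q^{2N})_\infty(pq^{2N-2}z^2;p,q^{2N})_\infty}{(q^{2N}z^2;p,q^{2N})_\infty(q^2z^{-2};p,q^{2N})_\infty(pz^2;p,q^{2N})_\infty(pq^{2N-2}z^{-2};p,q^{2N})_\infty},$$ $$\widetilde R(z,q,p)=z^{2/N-2}\frac1{\kappa(z^2)}\frac{\vartheta\left[{1/2\atop1/2}\right](\zeta,\tau)}{\vartheta\left[{1/2\atop1/2}\right](\xi+\zeta,\tau)}\sum_{\alpha_1,\alpha_2\in\mathbb Z_N}W_{(\alpha_1,\alpha_2)}(\xi,\zeta,\tau)\,I_{(\alpha_1,\alpha_2)}\otimes I_{(\alpha_1,\alpha_2)}^{-1},$$ $R(z)=R(z,q,p)=(g^{1/2}\otimes g^{1/2})\widetilde R(z,q,p)(g^{-1/2}\otimes g^{-1/2})$. Further $\tau_N(z)=z^{2/N-2}\Theta_{q^{2N}}(qz^2)/\Theta_{q^{2N}}(qz^{-2})$ (it satisfies $\tau_N(q^Nz)=\tau_N(z)$, $\tau_N(z^{-1})=\tau_N(z)^{-1}$), $\widehat R_{12}(x)=\tau_N(q^{1/2}x^{-1})R_{12}(x)$, $\widehat R^*_{12}(x)=\widehat R_{12}(x,q,p^* )$. Subscripts denote the tensor factors of copies of $\mathbb C^N$ acted on ($R_{21}$ is $R_{12}$ with the two spaces exchanged)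 and $t_i$ denotes transposition in space $i$. Known properties: $R_{12}(z)R_{13}(w)R_{23}(w/z)=R_{23}(w/z)R_{13}(w)R_{12}(z)$; $R_{12}(z)R_{21}(z^{-1})=1$; $R_{12}(z)^{t_2}R_{21}(q^{-N}z^{-1})^{t_2}=1$; $R_{12}(-z)=\omega(g^{-1}\otimes 1)R_{12}(z)(g\otimes1)$; $\widehat R_{12}(-p^{1/2}z)=(a\otimes1)^{-1}\widehat R_{21}(z^{-1})^{-1}(a\otimes1)$. Algebra. ${\cal A}_{q,p}(\widehat{gl}(N)_c)$ is the algebra generated by the entries (modes) of $L(z)=(L_{ij}(z))_{1\le i,j\le N}$, $L_{ij}(z)=\sum_{n\in\mathbb Z}L_{ij}(n)z^n$, with relations $\widehat R_{12}(z/w)L_1(z)L_2(w)=L_2(w)L_1(z)\widehat R^*_{12}(z/w)$, where $L_1=L\otimes 1$, $L_2=1\otimes L$; ${\cal A}_{q,p}(\widehat{sl}(N)_c)$ is its quotient by $q\text{-}\det L(z)=q^{c/2}$, where $q\text{-}\det L(z)=\sum_{\sigma\in{\mathfrak S}_N}\varepsilon(\sigma)\prod_{i=1}^NL_{i,\sigma(i)}(zq^{i-N-1})$ is central. The relations are understood as analytic (not merely formal series) relations in the spectral parameters. Derived operators. $L^+(z)=L(q^{c/2}z)$, $L^-(z)=a\,L(-p^{1/2}z)\,a^{-1}$ (assumed invertible), $\widetilde L^-(z)=(L^-(z)^{-1})^t$, ${\cal L}^{(n)}(z)=(a^{-n}L^+(q^{c/2}z))^t\,\widetilde L^-(z)$;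 ${\cal L}^{(n)}_i$ is ${\cal L}^{(n)}$ acting in the $i$-th of $s$ auxiliary spaces $\mathbb C^N$; the trace in $w_s$ is over these $s$ spaces. Conventions in $w_s$. Products over $i$ have the factor $i=1$ leftmost and $i=s$ rightmost; within each factor $j$ runs over $i+1,\dots,s$ increasing from left to right. $P_{ij}$ is the permutation operator between spaces $i$ and $j$ including the spectral parameters, i.e. moving $P_{ij}$ through an expression exchanges simultaneously the space labels $i,j$ and the spectral parameters $z_i,z_j$ attached to them: $P_{ij}X=X^{(ij)}P_{ij}$, with $X^{(ij)}$ obtained from $X$ by interchanging $(i,z_i)$ and $(j,z_j)$. Examples: $w_1(z)=\mathrm{Tr}[{\cal L}^{(n)}(z)]$; $w_2(z)=\mathrm{Tr}_{12}[P_{12}{\cal L}_1^{(n)}(z_1)\widehat R^*_{12}(q^{-N}z_1/z_2)^{t_1t_2}{\cal L}_2^{(n)}(z_2)]$; $w_3(z)=\mathrm{Tr}_{123}[P_{12}P_{13}P_{23}{\cal L}_1^{(n)}(z_1)\widehat R^*_{12}(q^{-N}z_1/z_2)^{t_1t_2}\widehat R^*_{13}(q^{-N}z_1/z_3)^{t_1t_3}{\cal L}_2^{(n)}(z_2)\widehat R^*_{23}(q^{-N}z_2/z_3)^{t_2t_3}{\cal L}_3^{(n)}(z_3)]$. Exchange algebra and limit. On $\Sigma_{N,n}$ the operators obey $w_i(z)w_j(w)=\prod_{u,v}{\cal Y}_N(n,q^{v-u}w/z)\,w_j(w)w_i(z)$ (same ranges of $u,v$) with $${\cal Y}_N(n,x)=\prod_{k}\frac{\Theta_{q^{2N}}^2(x^2p^{-k})\,\Theta_{q^{2N}}(x^2q^2p^k)\,\Theta_{q^{2N}}(x^2q^{-2}p^k)}{\Theta_{q^{2N}}^2(x^2p^k)\,\Theta_{q^{2N}}(x^2q^2p^{-k})\,\Theta_{q^{2N}}(x^2q^{-2}p^{-k})},$$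 $k$ running over $1,\dots,n$ for $n>0$ and over $0,\dots,|n|-1$ for $n<0$ (empty product for $n=0$); ${\cal Y}_N=1$ when $p=q^{Nh}$ (i.e. $\beta=0$). The limit $\beta\to0$ is taken with $q$ fixed and $p=q^{Nh/(1-\beta)}$, in the sense that the scalar structure function is expanded to first order in $\beta$. *)

(* Defs.v *)
(* The complex numbers are [R[i]] over an arbitrary [R : realType].

   All spectral parameters and all parameters with fractional powers are given
   by fixed logarithms in units of [i*pi]: a variable [xi] stands for the
   complex number z = e^{i pi xi}; q = e^{i pi zeta}, p = e^{2 i pi tau},
   q^x = e^{i pi zeta x}, p^{1/2} = e^{i pi tau}, ln q = i pi zeta.  So z/w is
   written [xi - xi'], and -p^{1/2} z is written [xi + 1 + tau]. *)

From HB Require Import structures.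
From mathcomp Require Import all_boot all_order all_algebra perm.
From mathcomp Require Import complex mxtens.
From mathcomp Require Import all_classical all_reals all_analysis.

Set Implicit Arguments.
Unset Strict Implicit.
Unset Printing Implicit Defensive.

Import Order.TTheory GRing.Theory Num.Theory.
Import numFieldNormedType.Exports.

Local Open Scope classical_set_scope.
Local Open Scope complex_scope.
Local Open Scope ring_scope.

(* The usual topology of the complex plane, induced by the modulus. *)
HB.instance Definition _ (R : realType) := NormedModule.copy R[i] R[i]^o.
HB.instance Definition _ (R : realType) := PseudoPointedMetric.copy R[i] R[i]^o.

Section Functions.
Variable R : realType.
Local Notation C := R[i].

Definition cexp (x : C) : C :=
  (expR (complex.Re x))%:C * (cos (complex.Im x) +i* sin (complex.Im x)).

Definition i_pi : C := 'i * (pi : R)%:C.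

Definition e_ipi (x : C) : C := cexp (i_pi * x).

Definition qpoch (x a : C) : C := limn (fun M : nat => \prod_(m < M) (1 - x * a ^+ m)).

Definition qpoch2 (x a b : C) : C :=
  limn (fun M : nat => \prod_(m < M) \prod_(l < M) (1 - x * a ^+ m * b ^+ l)).

Definition Theta (a x : C) : C := qpoch x a * qpoch (a * x^-1) a * qpoch a a.

(* The sum over all integers m, as a limit of sums over -M <= m < M. *)
Definition vartheta (g1 g2 xi tau : C) : C :=
  let term (m : int) : C :=
    cexp (i_pi * (m%:~R + g1) ^+ 2 * tau
          + 2 * i_pi * (m%:~R + g1) * (xi + g2)) in
  limn (fun M : nat => \sum_(m < M) (term m%:Z + term (- (m.+1)%:Z))).

End Functions.

Section RMatrix.
Variable R : realType.
Local Notation C := R[i].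
Variable N : nat.

(* The ordinal [i : 'I_N] is the index i + 1 in {1, ..., N}. *)

Definition gmx : 'M[C]_N := diag_mx (\row_(i < N) e_ipi (2 / N%:R) ^+ i.+1).

Definition hmx : 'M[C]_N := \matrix_(i < N, j < N) (j == ordS i)%:R.

Definition Imx (a1 a2 : nat) : 'M[C]_N := gmx ^+ a2 *m hmx ^+ a1.

Definition Wfun (a1 a2 : nat) (xi zeta tau : C) : C :=
  N%:R^-1 *
  (vartheta (2^-1 + a1%:R / N%:R) (2^-1 + a2%:R / N%:R) (xi + zeta / N%:R) tau
   / vartheta (2^-1 + a1%:R / N%:R) (2^-1 + a2%:R / N%:R) (zeta / N%:R) tau).

Definition kappa_inv (zeta tau xi : C) : C :=
  let q := e_ipi zeta in let p := e_ipi (2 * tau) in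
  let z2 := e_ipi (2 * xi) in let b := q ^+ (2 * N) in
  (qpoch2 (b * z2^-1) p b * qpoch2 (q ^+ 2 * z2) p b
   * qpoch2 (p * z2^-1) p b * qpoch2 (p * q ^+ (2 * N - 2) * z2) p b)
  / (qpoch2 (b * z2) p b * qpoch2 (q ^+ 2 * z2^-1) p b
     * qpoch2 (p * z2) p b * qpoch2 (p * q ^+ (2 * N - 2) * z2^-1) p b).

Definition Rtilde (zeta tau xi : C) : 'M[C]_(N * N) :=
  (e_ipi ((2 / N%:R - 2) * xi) * kappa_inv zeta tau xi
   * (vartheta 2^-1 2^-1 zeta tau / vartheta 2^-1 2^-1 (xi + zeta) tau))
  *: \sum_(a1 < N) \sum_(a2 < N)
       Wfun a1 a2 xi zeta tau *: (Imx a1 a2 *t invmx (Imx a1 a2)).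

(* [gh] is the chosen diagonal square root g^{1/2} of [gmx]. *)
Variable gh : 'M[C]_N.

Definition Rmx (zeta tau xi : C) : 'M[C]_(N * N) :=
  (gh *t gh) *m Rtilde zeta tau xi *m (invmx gh *t invmx gh).

Definition amx : 'M[C]_N := gh *m hmx *m gh.

Definition tauN (zeta xi : C) : C :=
  let q := e_ipi zeta in
  e_ipi ((2 / N%:R - 2) * xi)
  * (Theta (q ^+ (2 * N)) (q * e_ipi (2 * xi))
     / Theta (q ^+ (2 * N)) (q * e_ipi (- (2 * xi)))).

(* R-hat; the starred matrix R-hat^* is obtained with [tau_star] for [tau]. *)
Definition Rhat (zeta tau xi : C) : 'M[C]_(N * N) :=
  tauN zeta (zeta / 2 - xi) *: Rmx zeta tau xi.

(* p^* = p q^{-2c} *)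
Definition tau_star (zeta tau c : C) : C := tau - zeta * c.

(* z^2 lies outside the countable set of all p^k p^{*l} q^m, which contains
   the zeros and poles of R-hat and R-hat^*. *)
Definition generic (zeta tau c xi : C) : Prop :=
  forall k l m : int,
    e_ipi (2 * xi) !=
    e_ipi (2 * tau * k%:~R + 2 * tau_star zeta tau c * l%:~R + zeta * m%:~R).

End RMatrix.

Section Tensor.
Variables (A : pzRingType) (N s : nat).

(* Matrices over A on the s-fold tensor power of C^N: rows and columns are
   indexed by the enumeration of the multi-indices {ffun 'I_s -> 'I_N}. *)
Local Notation op := 'M[A]_#|{ffun 'I_s -> 'I_N}|.

Definition multi (I : 'I_#|{ffun 'I_s -> 'I_N}|) : {ffun 'I_s -> 'I_N} := enum_val I.

Definition on_space (i : 'I_s) (M : 'M[A]_N) : op :=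
  \matrix_(I, J)
    (if [forall k, (k != i) ==> (multi I k == multi J k)]
     then M (multi I i) (multi J i) else 0).

Definition on_spaces (i j : 'I_s) (M : 'M[A]_(N * N)) : op :=
  \matrix_(I, J)
    (if [forall k, (k != i) && (k != j) ==> (multi I k == multi J k)]
     then M (mxtens_index (multi I i, multi I j))
            (mxtens_index (multi J i, multi J j)) else 0).

Definition flip : 'M[A]_(N * N) :=
  \matrix_(I, J)
    (mxtens_unindex I == ((mxtens_unindex J).2, (mxtens_unindex J).1))%:R.

End Tensor.

Section Algebra.
Variable R : realType.
Local Notation C := R[i].
Variables (N : nat) (gh : 'M[C]_N).
Variables (zeta tau c : C).
Variables (A : algType C) (L Lminv : C -> 'M[A]_N).

Local Notation scal M := (map_mx (in_alg A) M).

Definition mxpowz (M : 'M[C]_N) (n : int) : 'M[C]_N :=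
  match n with Posz m => M ^+ m | Negz m => invmx M ^+ m.+1 end.

Definition qdet (xi : C) : A :=
  \sum_(sigma : 'S_N) (-1) ^+ sigma *
    \prod_(i < N) L (xi + zeta * ((i.+1)%:R - N%:R - 1)) i (sigma i).

Definition Lplus (xi : C) : 'M[A]_N := L (xi + zeta * c / 2).

Definition Lminus (xi : C) : 'M[A]_N :=
  scal (amx gh) *m L (xi + 1 + tau) *m scal (invmx (amx gh)).

(* [L] and [Lminv] realise the defining relations of A_{q,p}(sl^(N)_c) in the
   algebra [A], with [Lminv] the inverse of L^-.  As these are relations
   between analytic functions, the quadratic one is imposed away from the
   zeros and poles of the structure matrices. *)
Record Aqp_sl : Prop := {
  Aqp_RLL : forall xi xi' : C, generic zeta tau c (xi - xi') ->
    scal (Rhat gh zeta tau (xi - xi')) *m (L xi *t 1%:M) *m (1%:M *t L xi')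
    = (1%:M *t L xi') *m (L xi *t 1%:M)
      *m scal (Rhat gh zeta (tau_star zeta tau c) (xi - xi'));
  Aqp_qdet : forall xi : C, qdet xi = (e_ipi (zeta * c / 2))%:A;
  Aqp_LminusV : forall xi : C, Lminus xi *m Lminv xi = 1%:M;
  Aqp_LminusK : forall xi : C, Lminv xi *m Lminus xi = 1%:M }.

Definition calL (n : int) (xi : C) : 'M[A]_N :=
  (scal (mxpowz (amx gh) (- n)) *m Lplus (xi + zeta * c / 2))^T *m (Lminv xi)^T.

(* The trace defining w_s, for arbitrary z_1, ..., z_s (the entries of [x]).
   All permutation operators stand leftmost, so they act only as matrices. *)
Definition wtrace (n : int) (s : nat) (x : 'rV[C]_s) : A :=
  \tr ((\prod_(i < s) \prod_(j < s | (i < j)%N) on_spaces i j (flip A N))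
       *m \prod_(i < s)
            (on_space i (calL n (x 0 i))
             *m \prod_(j < s | (i < j)%N)
                  on_spaces i j
                    (scal (Rhat gh zeta (tau_star zeta tau c)
                             (- (zeta * N%:R) + x 0 i - x 0 j))^T))).

(* z_i = z q^{i - (s+1)/2} *)
Definition fused (s : nat) (xi : C) : 'rV[C]_s :=
  \row_(i < s) (xi + zeta * ((i.+1)%:R - (s.+1)%:R / 2)).

(* [y] is w_s(z).  At the fused points R-hat^* has zeros (z_i / z_{i+1} =
   q^{-1}), to be balanced against the poles of the product of the calL's, so
   the trace is taken there by analytic continuation: its correlators [corr]
   (matrix elements) tend to those of [y] when the z_i approach their fused
   values from generic position. *)
Definition is_w (K : Type) (corr : K -> {linear A -> C})
    (n : int) (s : nat) (xi : C) (y : A) : Prop :=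
  forall k : K,
    (fun x : 'rV[C]_s => corr k (wtrace n x))
      @ within [set x : 'rV[C]_s |
                 forall i j : 'I_s, (i < j)%N ->
                   generic zeta tau c (x 0 i - x 0 j)]
               (nbhs (fused s xi))
    --> corr k y.

End Algebra.

Section StructureFunction.
Variable R : realType.
Local Notation C := R[i].
Variable N : nat.

(* 1, ..., n for n >= 0 and 0, ..., |n| - 1 for n < 0. *)
Definition krange (n : int) : seq nat :=
  match n with Posz m => iota 1 m | Negz m => iota 0 m.+1 end.

(* Y_N(n, x) with x = e^{i pi xi}. *)
Definition Yfun (zeta tau : C) (n : int) (xi : C) : C :=
  let q := e_ipi zeta in let p := e_ipi (2 * tau) in
  let x2 := e_ipi (2 * xi) in let Th := Theta (q ^+ (2 * N)) in
  \prod_(k <- krange n)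
    ((Th (x2 * p ^- k) ^+ 2 * Th (x2 * q ^+ 2 * p ^+ k) * Th (x2 * q ^- 2 * p ^+ k))
     / (Th (x2 * p ^+ k) ^+ 2 * Th (x2 * q ^+ 2 * p ^- k) * Th (x2 * q ^- 2 * p ^- k))).

(* None of the theta functions in Y_N(n, x) vanishes. *)
Definition Yregular (zeta tau : C) (n : int) (xi : C) : Prop :=
  let q := e_ipi zeta in let p := e_ipi (2 * tau) in
  let x2 := e_ipi (2 * xi) in let Th := Theta (q ^+ (2 * N)) in
  forall k : nat, k \in krange n ->
  forall y : C, y \in [:: x2; x2 * q ^+ 2; x2 * q ^- 2] ->
    Th (y * p ^+ k) != 0 /\ Th (y * p ^- k) != 0.

(* The half-integers -(i-1)/2, ..., (i-1)/2. *)
Definition halfstep (i : nat) (a : 'I_i) : C := a%:R - i.-1%:R / 2.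

Definition structure_function (zeta tau : C) (n : int) (i j : nat) (xi : C) : C :=
  \prod_(a < i) \prod_(b < j)
    Yfun zeta tau n (zeta * (halfstep b - halfstep a) + xi).

(* 2y/(1-y) - yq^2/(1-yq^2) - yq^{-2}/(1-yq^{-2}) *)
Definition fterm (q y : C) : C :=
  2 * y / (1 - y) - y * q ^+ 2 / (1 - y * q ^+ 2) - y * q ^- 2 / (1 - y * q ^- 2).

(* For an int, (_ %/ 2)%Z rounds down. *)
Definition bracket_odd (q : C) (n : int) (x : C) : C :=
  let e1 : C := (((n %/ 2)%Z) * ((n %/ 2)%Z + 1))%:~R in
  let e2 : C := (((n + 1) %/ 2)%Z ^+ 2)%:~R in
  limn (fun M : nat => \sum_(l < M)
    (e1 * fterm q (x ^+ 2 * q ^+ (2 * N * l))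
     + e2 * fterm q (x ^+ 2 * q ^+ (2 * N * l + N))))
  - 2^-1 * e1 * fterm q (x ^+ 2).

Definition bracket_even (q : C) (x : C) : C :=
  limn (fun M : nat => \sum_(l < M) fterm q (x ^+ 2 * q ^+ (2 * N * l)))
  - 2^-1 * fterm q (x ^+ 2).

Definition f_h (zeta : C) (n h : int) (x : C) : C :=
  let q := e_ipi zeta in let lnq := i_pi R * zeta in
  if odd `|h|%N
  then 2 * N%:R * h%:~R * lnq * (bracket_odd q n x - bracket_odd q n x^-1)
  else N%:R * h%:~R * (n * (n + 1))%:~R * lnq
       * (bracket_even q x - bracket_even q x^-1).

Definition poisson_coefficient (zeta : C) (n h : int) (i j : nat) (xi : C) : C :=
  \sum_(a < i) \sum_(b < j)
    f_h zeta n h (e_ipi (zeta * (halfstep b - halfstep a) + xi)).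

(* p = q^{N h / (1 - beta)} *)
Definition tau_h (zeta : C) (h : int) (beta : C) : C :=
  zeta * N%:R * h%:~R / (2 * (1 - beta)).

End StructureFunction.

(* Main.v *)
Require Import Defs.
From HB Require Import structures.
From mathcomp Require Import all_boot all_order all_algebra perm.
From mathcomp Require Import complex mxtens.
From mathcomp Require Import all_classical all_reals all_analysis.
From mathcomp Require Import ring lra zify.
Import Order.TTheory GRing.Theory Num.Theory.
Import numFieldNormedType.Exports.
Import ComplexField.Normc.
Local Open Scope classical_set_scope.
Local Open Scope complex_scope.
Local Open Scope ring_scope.

Set Implicit Arguments.
Unset Strict Implicit.
Unset Printing Implicit Defensive.

(* Put b = q^{2N} and p = q^{Nh/(1-beta)}.  Every theta function in Y_N(n, x) is
   Theta_b(u e^{m s(beta)}) with s(0) = 0, s'(0) = N h ln q and p^k = q^{Nhk} at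
   beta = 0, so the first order in beta is a sum of logarithmic derivatives
   T(u) = u Theta_b'(u) / Theta_b(u).  They enter only through the second
   differences D(u) = T(u q^2) + T(u q^{-2}) - 2 T(u).  Quasi-periodicity
   Theta_b(b u) = - u^{-1} Theta_b(u) gives T(b u) = T(u) - 1, so D is invariant
   under u -> b u, and D(x^2 q^{Nhk}) depends on k only through the parity of hk.
   Expanding D over the zeros of Theta_b gives the series of f_h, and summing k
   over each parity class gives its coefficients.  The commutator then follows
   from w_i w_j - w_j w_i = (1 - S^{-1}) w_i w_j, S the structure function. *)

(** * Logarithmic derivatives *)

Section LogDerivative.
Variable K : numFieldType.
Implicit Types (f g : K -> K) (x d e : K).

Lemma is_derive_chain f g x d e :
  is_derive (g x) (1 : K) f d -> is_derive x (1 : K) g e ->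
  is_derive x (1 : K) (fun y => f (g y)) (d * e).
Proof.
move=> [df <-] [dg <-]; apply: DeriveDef.
  apply/derivable1_diffP; move: df dg => /derivable1_diffP df /derivable1_diffP dg.
  exact: differentiable_comp dg df.
move: df dg => /derivable1_diffP df /derivable1_diffP dg.
rewrite (deriveE _ (differentiable_comp dg df)) (diff_comp dg df) /=.
by rewrite (diff1E df) derive1E (deriveE _ dg); exact: mulrC.
Qed.

(* [d] is f'(x) / f(x). *)
Definition is_dlog f x d := f x != 0 /\ is_derive x (1 : K) f (d * f x).

Lemma is_dlog_unique f x d e : is_dlog f x d -> is_dlog f x e -> d = e.
Proof.
by move=> [fx0 [_ dE]] [_ [_ eE]]; apply: (mulIf fx0); rewrite -dE.
Qed.

Lemma is_dlog_cst (c : K) x : c != 0 -> is_dlog (fun=> c) x 0.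
Proof. by move=> c0; split=> //; rewrite mul0r; exact: is_derive_cst. Qed.

Lemma is_dlogM f g x d e :
  is_dlog f x d -> is_dlog g x e -> is_dlog (fun y => f y * g y) x (d + e).
Proof.
move=> [fx0 df] [gx0 dg]; split; first by rewrite mulf_neq0.
by apply: is_derive_eq; rewrite /GRing.scale /=; ring.
Qed.

Lemma is_dlogV f x d : is_dlog f x d -> is_dlog (fun y => (f y)^-1) x (- d).
Proof.
move=> [fx0 [df dfE]]; split; first by rewrite invr_eq0.
apply: DeriveDef; first exact: derivableV.
by rewrite deriveV// dfE /GRing.scale /=; field.
Qed.

Lemma is_dlog_comp f g x d e :
  is_dlog f (g x) d -> is_derive x (1 : K) g e ->
  is_dlog (fun y => f (g y)) x (d * e).
Proof.
move=> [fx0 df] dg; split=> //.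
by rewrite mulrAC; exact: is_derive_chain.
Qed.

Lemma is_dlog_prod (I : eqType) (r : seq I) (F : I -> K -> K) (D : I -> K) x :
  (forall k, k \in r -> is_dlog (F k) x (D k)) ->
  is_dlog (fun y => \prod_(k <- r) F k y) x (\sum_(k <- r) D k).
Proof.
elim: r => [|a r IHr] FD.
  rewrite big_nil (_ : (fun y => _) = fun=> 1); last first.
    by apply/funext => y; rewrite big_nil.
  exact/is_dlog_cst/oner_neq0.
rewrite big_cons (_ : (fun y => _) = fun y => F a y * \prod_(k <- r) F k y).
  apply: is_dlogM; first exact/FD/mem_head.
  by apply: IHr => k kr; apply: FD; rewrite in_cons kr orbT.
by apply/funext => y; rewrite big_cons.
Qed.

(** When f(0) = 1 the logarithmic derivative at 0 is the first-order coefficient of f; this turns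
    logarithmic derivatives in beta into limits as beta tends to 0. *)
Lemma is_dlog_cvg f d :
  is_dlog f 0 d -> f 0 = 1 -> (fun y => y^-1 * (f y - 1)) @ 0^' --> d.
Proof.
move=> [_ [df dfE]] f0; rewrite -[d]mulr1 -f0 -dfE.
move/cvg_ex : df => [l fl]; rewrite (_ : 'D_1 f 0 = l); last exact: cvg_lim fl.
apply: cvg_trans fl; apply: near_eq_cvg; near=> y.
by rewrite /= addr0 /GRing.scale /= mulr1.
Unshelve. all: by end_near. Qed.

End LogDerivative.

(** * Convergence and the exponential in the complex plane *)

Section ComplexPlane.
Variable R : realType.
Local Notation C := R[i].

Lemma normc_real (x : R) : `|x%:C| = `|x|%:C :> C.
Proof. by rewrite normc_def /= expr0n /= addr0 sqrtr_sqr. Qed.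

Lemma normc_ge_Im (z : C) : `|complex.Im z|%:C <= `|z|.
Proof.
rewrite -(normrN (complex.Im z)) -ReiNIm; apply: le_trans (normc_ge_Re _) _.
by rewrite normrM [X in _ * X]normc_def /= expr0n /= expr1n add0r sqrtr1 mulr1.
Qed.

Lemma gt0_complexE (e : C) : 0 < e -> exists2 d : R, 0 < d & e = d%:C.
Proof.
move=> e0; exists (complex.Re e); first by move: e0; rewrite ltcE => /andP[].
by rewrite RRe_real// gtr0_real.
Qed.

Section Filtered.
Variables (T : Type) (F : set_system T).
Context {FF : Filter F}.

Lemma cvg_real_complex (f : T -> R) (l : R) :
  f @ F --> l -> (fun t => (f t)%:C) @ F --> (l%:C : C).
Proof.
move=> fl; apply/cvgrPdist_lt => e /gt0_complexE [d d0 ->].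
near=> t; rewrite -rmorphB normc_real ltcR.
by near: t; move/cvgrPdist_lt : fl; apply.
Unshelve. all: by end_near. Qed.

Lemma cvg_Re (f : T -> C) (l : C) :
  f @ F --> l -> (fun t => complex.Re (f t)) @ F --> complex.Re l.
Proof.
move=> fl; apply/cvgrPdist_lt => e e0.
near=> t; rewrite -ltcR -raddfB; apply: le_lt_trans (normc_ge_Re _) _.
by near: t; move/cvgrPdist_lt : fl; apply; rewrite ltcR.
Unshelve. all: by end_near. Qed.

Lemma cvg_Im (f : T -> C) (l : C) :
  f @ F --> l -> (fun t => complex.Im (f t)) @ F --> complex.Im l.
Proof.
move=> fl; apply/cvgrPdist_lt => e e0.
near=> t; rewrite -ltcR -raddfB; apply: le_lt_trans (normc_ge_Im _) _.
by near: t; move/cvgrPdist_lt : fl; apply; rewrite ltcR.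
Unshelve. all: by end_near. Qed.

End Filtered.

(** Telescoping turns [u] into a series dominated by a geometric one. *)
Lemma is_cvg_geometric_step_real (u : nat -> R) (k r : R) :
  0 <= r < 1 -> (forall n, `|u n.+1 - u n| <= k * r ^+ n) -> cvgn u.
Proof.
move=> /andP[r0 r1] uk.
rewrite (_ : u = fun n => u 0%N + series (telescope u) n); last first.
  by apply/funext => n; rewrite -eq_sum_telescope.
apply: is_cvgD; first exact: is_cvg_cst.
apply: normed_cvg; apply: (@series_le_cvg _ _ (geometric k r)) => //.
- by move=> n; exact: normr_ge0.
- by move=> n; exact: le_trans (normr_ge0 _) (uk n).
- by apply: is_cvg_geometric_series; rewrite ger0_norm.
Qed.

Lemma is_cvg_geometric_step (u : nat -> C) (k r : R) :
  0 <= r < 1 -> (forall n, `|u n.+1 - u n| <= (k * r ^+ n)%:C) -> cvgn u.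
Proof.
move=> r01 uk.
have /cvg_ex [a ua] : cvgn (fun n => complex.Re (u n)).
  apply: (is_cvg_geometric_step_real (k := k) r01) => n.
  by rewrite -raddfB -lecR; apply: le_trans (normc_ge_Re _) (uk n).
have /cvg_ex [b ub] : cvgn (fun n => complex.Im (u n)).
  apply: (is_cvg_geometric_step_real (k := k) r01) => n.
  by rewrite -raddfB -lecR; apply: le_trans (normc_ge_Im _) (uk n).
rewrite (_ : u = fun n => (complex.Re (u n))%:C + 'i * (complex.Im (u n))%:C).
  apply/cvg_ex; exists (a%:C + 'i * b%:C).
  apply: cvgD; first exact: cvg_real_complex.
  by apply: cvgM; [exact: cvg_cst|exact: cvg_real_complex].
by apply/funext => n; rewrite -complexE.
Qed.

Lemma cexp0 : cexp (0 : C) = 1.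
Proof. by rewrite /cexp /= expR0 cos0 sin0 mul1r. Qed.

Lemma cexpD (x y : C) : cexp (x + y) = cexp x * cexp y.
Proof.
case: x y => [a b] [a' b']; rewrite /cexp /= expRD cosD sinD.
by apply/eqP; rewrite eq_complex /=; apply/andP; split; apply/eqP; ring.
Qed.

(** The neighbourhood is a full one, x = 0 included, so that the estimate can be pulled back along
    real and imaginary parts, which may vanish at z != 0. *)
Lemma near0_linear_approx (K : numFieldType) (f : K -> K) (d e : K) :
  is_derive (0 : K) (1 : K) f d -> 0 < e ->
  \forall x \near (0 : K), `|f x - f 0 - d * x| <= e * `|x|.
Proof.
move=> [df dE] e0.
have : (fun h => h^-1 *: (f (h *: 1 + 0) - f 0)) @ (0 : K)^' --> d.
  by move/cvg_ex : df => [l fl]; rewrite -dE (_ : 'D_1 f 0 = l) //; exact: cvg_lim fl.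
move=> /cvgrPdist_le /(_ _ e0); rewrite near_withinE; apply: filterS => x xP.
have [->|x0] := eqVneq x 0; first by rewrite subrr mulr0 subr0 normr0 mulr0.
have := xP x0; rewrite addr0 /GRing.scale /= mulr1 => H.
rewrite -[X in `|X|](divfK x0) normrM ler_wpM2r//.
by rewrite mulrBl mulfK// -normrN opprB [(_ - _) / x]mulrC.
Qed.

Lemma is_derive_linear_approx (K : numFieldType) (f : K -> K) (x d : K) :
  (forall e, 0 < e ->
    \forall h \near (0 : K), `|f (h + x) - f x - d * h| <= e * `|h|) ->
  is_derive x (1 : K) f d.
Proof.
move=> fd.
have H : (fun h => h^-1 *: (f (h *: 1 + x) - f x)) @ (0 : K)^' --> d.
  apply/cvgrPdist_le => e e0; rewrite near_withinE.
  near=> h => h0; rewrite /GRing.scale /= mulr1.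
  rewrite -[X in `|X|](mulfK h0) normrM normfV ler_pdivrMr ?normr_gt0//.
  rewrite mulrBl mulrAC mulVf// mul1r -normrN opprB.
  by near: h; exact: fd.
by apply: DeriveDef; [exact: cvgP H|exact: cvg_lim H].
Unshelve. all: by end_near. Qed.

(** [cexp] is built from real functions, so its complex derivative comes from the first-order
    expansions of [expR], [cos] and [sin] at 0. *)
Lemma is_derive_cexp0 : is_derive (0 : C) (1 : C) (@cexp R) 1.
Proof.
apply: is_derive_linear_approx => e /gt0_complexE[d d0 ->].
(* The real and imaginary parts of the remainder will each be at most 3 m |z|, whence the 6; m <= 1
   serves to bound the real exponential factor by 2. *)
pose m := Num.min (d / 6) 1.
have m0 : 0 < m by rewrite lt_min divr_gt0//= ltr01.
have m1 : m <= 1 by rewrite ge_min lexx orbT.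
have md : m <= d / 6 by rewrite ge_min lexx.
have Re0 : (fun z : C => complex.Re z) @ (0 : C) --> (0 : R).
  by have := @cvg_Re C (nbhs (0 : C)) _ id 0; apply; exact: cvg_id.
have Im0 : (fun z : C => complex.Im z) @ (0 : C) --> (0 : R).
  by have := @cvg_Im C (nbhs (0 : C)) _ id 0; apply; exact: cvg_id.
have eN : \forall z \near (0 : C),
    `|expR (complex.Re z) - 1 - complex.Re z| <= m * `|complex.Re z|.
  have approx := near0_linear_approx (is_derive_expR (0 : R)) m0.
  by apply: (@filterS _ (nbhs (0 : C)) _ _ _ _ (Re0 _ approx)) => z /=;
    rewrite expR0 mul1r.
have cN : \forall z \near (0 : C), `|cos (complex.Im z) - 1| <= m * `|complex.Im z|.
  have approx := near0_linear_approx (is_derive_cos (0 : R)) m0.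
  by apply: (@filterS _ (nbhs (0 : C)) _ _ _ _ (Im0 _ approx)) => z /=;
    rewrite cos0 sin0 oppr0 mul0r subr0.
have sN : \forall z \near (0 : C),
    `|sin (complex.Im z) - complex.Im z| <= m * `|complex.Im z|.
  have approx := near0_linear_approx (is_derive_sin (0 : R)) m0.
  by apply: (@filterS _ (nbhs (0 : C)) _ _ _ _ (Im0 _ approx)) => z /=;
    rewrite cos0 sin0 subr0 mul1r.
have aN : \forall z \near (0 : C), `|complex.Re z| <= m / 2.
  by move/cvgr0Pnorm_le : Re0; apply; rewrite divr_gt0.
near=> z; rewrite addr0 cexp0.
have eE : `|expR (complex.Re z) - 1 - complex.Re z| <= m * `|complex.Re z| by near: z.
have cE : `|cos (complex.Im z) - 1| <= m * `|complex.Im z| by near: z.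
have sE : `|sin (complex.Im z) - complex.Im z| <= m * `|complex.Im z| by near: z.
have aE : `|complex.Re z| <= m / 2 by near: z.
have := normc_ge_Re z; have := normc_ge_Im z.
have [r zr] : exists r, `|z| = r%:C by rewrite normc_def; eexists.
rewrite mul1r zr !lecR => zIm zRe.
rewrite [z in _ - z]complexE /cexp.
move: (complex.Re z) (complex.Im z) eE cE sE aE zIm zRe => a b eE cE sE aE br ar.
set A := expR a in eE *; set c := cos b in cE *; set s := sin b in sE *.
have AE : `|A - 1| <= m.
  rewrite -[A - 1](subrK a); apply: le_trans (ler_normD _ _) _.
  have : m * `|a| <= m / 2 by rewrite ler_pM2l//; lra.
  lra.
have A2 : `|A| <= 2.
  by rewrite -[A](subrK 1); apply: le_trans (ler_normD _ _) _; rewrite normr1; lra.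
(* Each summand is a first-order remainder times a bounded factor, except (A - 1) b, a product of
   two small quantities. *)
rewrite (_ : _ - _ = (A * (c - 1) + (A - 1 - a))%:C
    + 'i * (A * (s - b) + (A - 1) * b)%:C); last first.
  by apply/eqP; rewrite eq_complex /=; apply/andP; split; apply/eqP; ring.
apply: le_trans (ler_normD _ _) _; rewrite normrM normc_real.
have -> : `|'i : C| = 1 by rewrite normc_def /= expr0n /= expr1n add0r sqrtr1.
rewrite mul1r normc_real -rmorphD -rmorphM lecR.
have r0 : 0 <= r by apply: le_trans ar.
have mr : 6 * (m * r) <= d * r by rewrite mulrA ler_wpM2r//; lra.
have mar : m * `|a| <= m * r by rewrite ler_pM2l.
have mbr : m * `|b| <= m * r by rewrite ler_pM2l.
have h1 : `|A * (c - 1)| <= 2 * (m * r).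
  by rewrite normrM ler_pM//; exact: le_trans mbr.
have h2 : `|A * (s - b)| <= 2 * (m * r).
  by rewrite normrM ler_pM//; exact: le_trans mbr.
have h3 : `|(A - 1) * b| <= m * r by rewrite normrM ler_pM.
have h4 := ler_normD (A * (c - 1)) (A - 1 - a).
have h5 := ler_normD (A * (s - b)) ((A - 1) * b).
lra.
Unshelve. all: by end_near. Qed.

End ComplexPlane.

(** * Infinite products *)

Section InfiniteProduct.
Variable R : realType.
Local Notation C := R[i].

(** [normc] is the modulus with values in [R]; the estimates below are made there, where [lra]
    applies. *)
Lemma normcD_le (x y : C) : normc (x + y) <= normc x + normc y.
Proof. by rewrite -lecR rmorphD/=; exact: (@ler_normD _ C). Qed.

Lemma normc_ge0 (x : C) : 0 <= normc x.
Proof. by rewrite -lecR; exact: (@normr_ge0 _ C). Qed.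

Lemma normc_opp (x : C) : normc (- x) = normc x.
Proof. by apply: complexI; exact: (@normrN _ C). Qed.

(** * Estimates for partial products on a disc *)

Section Partial.
Variable c : nat -> C.

Definition pprod (M : nat) (x : C) : C := \prod_(m < M) (1 - x * c m).

(** The derivative of [pprod M], by the product rule in a form without division, so that it makes
    sense also where a factor vanishes. *)
Fixpoint dpprod (M : nat) (x : C) : C :=
  if M is M'.+1 then dpprod M' x * (1 - x * c M') - c M' * pprod M' x else 0.

Lemma pprodS M x : pprod M.+1 x = pprod M x * (1 - x * c M).
Proof. by rewrite /pprod big_ord_recr. Qed.

Lemma dpprodE M x : pprod M x != 0 ->
  dpprod M x = - (pprod M x * \sum_(m < M) c m / (1 - x * c m)).
Proof.
elim: M => [|M IHM]; first by rewrite big_ord0 mulr0 oppr0.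
rewrite pprodS mulf_eq0 negb_or => /andP[/IHM {}IHM xc].
by rewrite /= IHM big_ord_recr /=; field.
Qed.

Variable r : R.
Hypothesis r0 : 0 <= r.

Local Notation B M := (\prod_(m < M) (1 + r * normc (c m))).
Local Notation S M := (\sum_(m < M) normc (c m)).

Lemma prod_bound_ge0 M : 0 <= B M.
Proof.
by apply: prodr_ge0 => m _; rewrite addr_ge0// mulr_ge0// normc_ge0.
Qed.

Lemma sum_bound_ge0 M : 0 <= S M.
Proof. by apply: sumr_ge0 => m _; exact: normc_ge0. Qed.

Lemma normc_factor x m : normc x <= r -> normc (1 - x * c m) <= 1 + r * normc (c m).
Proof.
move=> xr; apply: le_trans (normcD_le _ _) _.
rewrite normc1 lerD2l normc_opp normcM.
by rewrite ler_wpM2r// normc_ge0.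
Qed.

Lemma pprod_le M x : normc x <= r -> normc (pprod M x) <= B M.
Proof.
move=> xr; elim: M => [|M IHM]; first by rewrite /pprod !big_ord0 normc1.
rewrite pprodS big_ord_recr /= normcM ler_pM ?normc_ge0//.
exact: normc_factor.
Qed.

(** By induction: a new factor splits the difference into the old one times 1 - x c_M and a term (x
    - y) c_M times a partial product. The increments of [B] and [S] absorb both. *)
Lemma pprod_lipschitz M x y : normc x <= r -> normc y <= r ->
  normc (pprod M x - pprod M y) <= normc (x - y) * (B M * S M).
Proof.
move=> xr yr; elim: M => [|M IHM].
  by rewrite /pprod !big_ord0 subrr normc0 !mulr0.
rewrite !pprodS (_ : _ - _ = (pprod M x - pprod M y) * (1 - x * c M)
    + - ((x - y) * c M * pprod M y)); last by ring.
apply: le_trans (normcD_le _ _) _; rewrite !big_ord_recr /=.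
rewrite normc_opp !normcM.
have := normc_factor M xr; have := pprod_le M yr.
move: IHM (prod_bound_ge0 M) (sum_bound_ge0 M).
have := normc_ge0 (pprod M x - pprod M y); have := normc_ge0 (1 - x * c M).
have := normc_ge0 (c M); have := normc_ge0 (x - y); have := normc_ge0 (pprod M y).
set b := B M; set s := S M.
move: (normc (pprod _ _)) (normc (pprod _ _ - _)) (normc (1 - _)) (normc (c M)).
move: (normc (x - y)).
move=> h p d f g p0 h0 g0 f0 d0 dh b0 s0 pb fr.
have df : d * f <= h * (b * s) * (1 + r * g) by rewrite ler_pM.
have hp : h * g * p <= h * g * b by rewrite ler_wpM2l// mulr_ge0.
(* The amount by which the bound for M + 1 exceeds the sum of the two estimates above. *)
have : 0 <= h * g * b * (r * g) by rewrite !mulr_ge0.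
lra.
Qed.

Lemma dpprod_le M x : normc x <= r -> normc (dpprod M x) <= B M * S M.
Proof.
move=> xr; elim: M => [|M IHM]; first by rewrite !big_ord0 normc0 mulr0.
rewrite /=; apply: le_trans (normcD_le _ _) _; rewrite !big_ord_recr /=.
rewrite normc_opp !normcM.
have := normc_factor M xr; have := pprod_le M xr.
move: IHM (prod_bound_ge0 M) (sum_bound_ge0 M).
have := normc_ge0 (dpprod M x); have := normc_ge0 (1 - x * c M).
have := normc_ge0 (c M); have := normc_ge0 (pprod M x).
set b := B M; set s := S M.
move: (normc (pprod _ _)) (normc (dpprod _ _)) (normc (1 - _)) (normc (c M)).
move=> p d f g p0 g0 f0 d0 db b0 s0 pb fr.
have df : d * f <= b * s * (1 + r * g) by rewrite ler_pM.
have gp : g * p <= g * b by rewrite ler_wpM2l.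
have : 0 <= b * g * (r * g) by rewrite !mulr_ge0.
lra.
Qed.

(* The bound is uniform in M, so that differentiation commutes with the limit of
   the partial products. *)
Lemma pprod_taylor M x y : normc x <= r -> normc y <= r ->
  normc (pprod M x - pprod M y - (x - y) * dpprod M y)
    <= normc (x - y) ^+ 2 * (B M * S M ^+ 2).
Proof.
move=> xr yr; elim: M => [|M IHM].
  by rewrite /pprod !big_ord0 subrr mulr0 subr0 normc0 expr0n /= !mulr0.
rewrite !pprodS /= (_ : _ - _ = (pprod M x - pprod M y - (x - y) * dpprod M y)
    * (1 - y * c M) + - ((x - y) * c M * (pprod M x - pprod M y))); last by ring.
apply: le_trans (normcD_le _ _) _; rewrite !big_ord_recr /=.
rewrite normc_opp !normcM.
have := normc_factor M yr; have := pprod_lipschitz M xr yr.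
move: IHM (prod_bound_ge0 M) (sum_bound_ge0 M).
have := normc_ge0 (pprod M x - pprod M y - (x - y) * dpprod M y).
have := normc_ge0 (pprod M x - pprod M y); have := normc_ge0 (1 - y * c M).
have := normc_ge0 (c M); have := normc_ge0 (x - y).
set b := B M; set s := S M.
move: (normc (_ - _ - _)) (normc (pprod _ _ - _)) (normc (1 - _)) (normc (c M)).
move: (normc (x - y)).
move=> h e d f g h0 g0 f0 d0 e0 eh b0 s0 dh fr.
have df : e * f <= h ^+ 2 * (b * s ^+ 2) * (1 + r * g) by rewrite ler_pM.
have hp : h * g * d <= h * g * (h * (b * s)) by rewrite ler_wpM2l// mulr_ge0.
have h1 : 0 <= h ^+ 2 * (b * (g * s)) by rewrite !mulr_ge0// exprn_ge0.
have h2 : 0 <= h ^+ 2 * (b * g ^+ 2) by rewrite !mulr_ge0// exprn_ge0.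
have h3 : 0 <= h ^+ 2 * (b * (g * s)) * (r * g) by rewrite !mulr_ge0// exprn_ge0.
have h4 : 0 <= h ^+ 2 * (b * g ^+ 2) * (r * g) by rewrite !mulr_ge0// exprn_ge0.
lra.
Qed.

End Partial.

(** * The infinite product and its derivative *)

Section Limit.
Variables (c : nat -> C) (rho : R).
Hypotheses (rho01 : 0 <= rho < 1) (c_rho : forall m, normc (c m) <= rho ^+ m).

Let S := (1 - rho)^-1.
Let B (r : R) := expR (r * S).

Lemma sum_bound M : \sum_(m < M) normc (c m) <= S.
Proof.
have /andP[rho0 rho1] := rho01.
apply: (@le_trans _ _ (\sum_(m < M) rho ^+ m)).
  by apply: ler_sum => m _; exact: c_rho.
rewrite /S -[leRHS]mul1r ler_pdivlMr ?subr_gt0// mulrC -opprB mulNr -subrX1 opprB.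
by rewrite lerBlDr lerDl exprn_ge0.
Qed.

(** From 1 + t <= exp t, factor by factor, and the geometric bound on the sum of the |c_m|. *)
Lemma prod_bound r M : 0 <= r -> \prod_(m < M) (1 + r * normc (c m)) <= B r.
Proof.
move=> r0; apply: (@le_trans _ _ (expR (r * \sum_(m < M) normc (c m)))); last first.
  by rewrite ler_expR ler_wpM2l// sum_bound.
rewrite mulr_sumr expR_sum; apply: ler_prod => m _.
by rewrite expR_ge1Dx addr_ge0// mulr_ge0// normc_ge0.
Qed.

Lemma is_cvg_pprod x : cvgn (fun M => pprod c M x).
Proof.
apply: (is_cvg_geometric_step (k := B (normc x) * normc x) rho01) => M.
rewrite [leLHS]/(normc _)%:C lecR pprodS mulrBr mulr1 addrAC subrr sub0r normc_opp.
rewrite !normcM mulrA ler_pM ?mulr_ge0 ?normc_ge0//.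
rewrite ler_wpM2r ?normc_ge0//.
exact: le_trans (pprod_le c M (lexx _)) (prod_bound M (normc_ge0 x)).
Qed.

Lemma is_cvg_dpprod x : cvgn (fun M => dpprod c M x).
Proof.
have x0 := normc_ge0 x.
apply: (is_cvg_geometric_step
  (k := B (normc x) * S * normc x + B (normc x)) rho01) => M.
rewrite [leLHS]/(normc _)%:C lecR /=.
rewrite (_ : _ - _ = - ((dpprod c M x * x + pprod c M x) * c M)); last by ring.
rewrite normc_opp normcM ler_pM ?normc_ge0//.
apply: le_trans (normcD_le _ _) _; rewrite normcM lerD//; last first.
  exact: le_trans (pprod_le c M (lexx _)) (prod_bound M x0).
rewrite ler_wpM2r//; apply: le_trans (dpprod_le c x0 M (lexx _)) _.
by rewrite ler_pM ?prod_bound_ge0 ?sum_bound_ge0 ?sum_bound ?prod_bound.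
Qed.

Lemma pprod_is_derive x d :
  (fun M => dpprod c M x) @ \oo --> d ->
  is_derive x (1 : C) (fun y => limn (fun M => pprod c M y)) d.
Proof.
move=> xd; apply: is_derive_linear_approx => e /gt0_complexE[a a0 ->].
(* The disc of radius [r] contains x and all x + h with |h| <= 1, and [K] bounds the Taylor
   coefficient there for every M. *)
pose r := normc x + 1; have r0 : 0 <= r by rewrite addr_ge0 ?normc_ge0.
pose K := B r * S ^+ 2.
have K0 : 0 <= K by rewrite mulr_ge0 ?expR_ge0// sqr_ge0.
pose m := Num.min 1 (a / (K + 1)).
have m0 : 0 < m by rewrite lt_min ltr01 divr_gt0// ltr_wpDl.
have ma : m * K <= a.
  apply: (@le_trans _ _ (a / (K + 1) * K)).
    by rewrite ler_wpM2r// ge_min lexx orbT.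
  by rewrite mulrAC ler_pdivrMr ?ltr_wpDl// ler_wpM2l ?lerDl// ltW.
have m1 : m <= 1 by rewrite ge_min lexx.
near=> h.
have : `|h| <= m%:C by near: h; apply: nbhs0_le; rewrite ltcR.
rewrite [`|h|]/(normc _)%:C lecR => hm.
rewrite [leLHS]/(normc _)%:C -rmorphM lecR.
apply: (@le_trans _ _ (normc h ^+ 2 * K)); last first.
  rewrite expr2 mulrAC ler_wpM2r ?normc_ge0//; apply: le_trans ma.
  by rewrite ler_wpM2r.
have hr : normc (h + x) <= r.
  by rewrite addrC; apply: le_trans (normcD_le _ _) _; rewrite lerD2l (le_trans hm).
have xr : normc x <= r by rewrite lerDl.
have H : (fun M => pprod c M (h + x) - pprod c M x - (h + x - x) * dpprod c M x)
    @ \oo --> limn (fun M => pprod c M (h + x)) - limn (fun M => pprod c M x) - d * h.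
  apply: cvgB; first by apply: cvgB; exact: is_cvg_pprod.
  by rewrite addrK [d * h]mulrC; exact: cvgM (cvg_cst h) xd.
(* The norm is a complex number with zero imaginary part; its real part is taken so that the
   inequality passes to the limit in [R]. *)
have {}H := cvg_Re (cvg_norm H); have {}H := H eventually_filter eventually_filter.
rewrite -[leLHS](cvg_lim _ H)//; apply: limr_le; first exact: cvgP H.
near=> M; apply: le_trans (pprod_taylor c r0 M hr xr) _.
rewrite addrK ler_wpM2l ?sqr_ge0// ler_pM ?prod_bound_ge0 ?sqr_ge0 ?prod_bound//.
rewrite ler_pXn2r ?nnegrE ?sum_bound_ge0 ?sum_bound//.
exact: le_trans (sum_bound_ge0 c 0) (sum_bound 0).
Unshelve. all: by end_near. Qed.

(* A nonzero infinite product has no vanishing partial product; the partial sums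
   are then - P_M'(x) / P_M(x), whose limit exists. *)
Lemma pprod_is_dlog x : limn (fun M => pprod c M x) != 0 ->
  exists2 l, (fun M => \sum_(m < M) c m / (1 - x * c m)) @ \oo --> l &
    is_dlog (fun y => limn (fun M => pprod c M y)) x (- l).
Proof.
set f := limn _ => f0.
have P0 M : pprod c M x != 0.
  apply: contra f0 => /eqP PM; apply/eqP/cvg_lim => //.
  rewrite -(cvg_shiftn M) (_ : (fun n => _) = cst 0); first exact: cvg_cst.
  apply/funext => n; elim: n => [|n IHn]; first by rewrite add0n PM.
  by rewrite addSn pprodS IHn mul0r.
have /cvg_ex[d xd] := @is_cvg_dpprod x.
exists (- (d / f)); last first.
  by split; [exact: f0|rewrite opprK (divfK f0); exact: pprod_is_derive].
rewrite (_ : (fun M => _) = fun M => - (dpprod c M x / pprod c M x)); last first.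
  by apply/funext => M; rewrite dpprodE// mulNr opprK mulrAC divff// mul1r.
have fx : (fun M => pprod c M x) @ \oo --> f by exact: is_cvg_pprod.
exact: cvgN (cvgM xd (cvgV f0 fx)).
Qed.

End Limit.
End InfiniteProduct.

(** * Theta functions *)

Section Theta.
Variable R : realType.
Local Notation C := R[i].

Lemma is_dlog_cexp (c : C) : is_dlog (fun t : C => cexp (c * t)) 0 c.
Proof.
split; first by rewrite mulr0 cexp0 oner_neq0.
rewrite mulr0 cexp0 [c * 1]mulrC; apply: (is_derive_chain (g := fun t => c * t)).
  by rewrite mulr0; exact: is_derive_cexp0.
by apply: is_derive_eq; rewrite /GRing.scale /= mulr1.
Qed.

Lemma cexp_neq0 (x : C) : cexp x != 0.
Proof.
apply/eqP => x0; have /eqP := cexpD x (- x).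
by rewrite subrr cexp0 x0 mul0r oner_eq0.
Qed.

Lemma cexpMn (x : C) n : cexp (n%:R * x) = cexp x ^+ n.
Proof.
elim: n => [|n IHn]; first by rewrite mul0r cexp0 expr0.
by rewrite -natr1 mulrDl mul1r cexpD IHn exprSr.
Qed.

Lemma cexpN (x : C) : cexp (- x) = (cexp x)^-1.
Proof.
by apply: (mulfI (cexp_neq0 x)); rewrite -cexpD subrr cexp0 divff// cexp_neq0.
Qed.

Lemma cexpMz (x : C) (m : int) : cexp (m%:~R * x) = cexp x ^ m.
Proof.
case: m => n; first by rewrite -pmulrn cexpMn.
by rewrite NegzE mulrNz mulNr cexpN -pmulrn cexpMn.
Qed.

Variable b : C.
Hypotheses (b_lt1 : `|b| < 1) (b_neq0 : b != 0).

Let rho01 : 0 <= normc b < 1.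
Proof. by rewrite normc_ge0 -ltcR. Qed.

Let b_rho m : normc (b ^+ m) <= normc b ^+ m.
Proof.
by elim: m => [|m IHm]; rewrite ?normc1// !exprS normcM ler_wpM2l// normc_ge0.
Qed.

Lemma is_cvg_qpoch x :
  (fun M => \prod_(m < M) (1 - x * b ^+ m)) @ \oo --> qpoch x b.
Proof. exact: (@is_cvg_pprod _ _ _ rho01 b_rho x). Qed.

Lemma qpochS x : qpoch x b = (1 - x) * qpoch (b * x) b.
Proof.
apply/cvg_lim => //; rewrite -cvg_shiftS.
rewrite (_ : [sequence _]_n = fun n => (1 - x) * \prod_(m < n) (1 - b * x * b ^+ m)).
  exact: cvgM (cvg_cst (1 - x)) (@is_cvg_qpoch (b * x)).
apply/funext => n; rewrite /= big_ord_recl expr0 mulr1; congr (_ * _).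
by apply: eq_bigr => m _; rewrite lift0 exprS; congr (1 - _); ring.
Qed.

(** The shift takes the factor 1 - x out of the first product and puts 1 - x^-1 = - x^-1 (1 - x)
    into the second. *)
Lemma ThetaS x : x != 0 -> Theta b (b * x) = - x^-1 * Theta b x.
Proof.
move=> x0; rewrite /Theta invfM mulVKf//.
by rewrite (qpochS x) (qpochS x^-1); field.
Qed.

(** The constant is (-1)^n b^(-n(n-1)/2). Its independence of x is what matters: it disappears from
    logarithmic derivatives and cancels in the quotients of Y_N. *)
Lemma Theta_shift_nat n :
  exists2 c, c != 0 & forall x, x != 0 -> Theta b (b ^+ n * x) = c * x ^- n * Theta b x.
Proof.
elim: n => [|n [c c0 IHn]].
  by exists 1; rewrite ?oner_neq0// => x x0; rewrite !expr0 invr1 !mul1r.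
exists (- c / b ^+ n); first by rewrite mulf_neq0 ?oppr_eq0// invr_eq0 expf_neq0.
move=> x x0; rewrite exprS -mulrA ThetaS ?mulf_neq0 ?expf_neq0// IHn// exprS.
by field; rewrite x0 !expf_neq0.
Qed.

Lemma Theta_shift (m : int) :
  exists2 c, c != 0 &
    forall x, x != 0 -> Theta b (b ^ m * x) = c * x ^ (- m) * Theta b x.
Proof.
case: m => n.
  have [c c0 cP] := Theta_shift_nat n; exists c => // x x0.
  by rewrite -exprnN -exprnP cP.
have [c c0 cP] := Theta_shift_nat n.+1.
have bn0 : b ^+ n.+1 != 0 by rewrite expf_neq0.
(* The positive shift is applied at y = b^-(n+1) x and solved for Theta(y); the extra power of b
   comes from rewriting y^(n+1) in terms of x. *)
exists (c^-1 * (b ^- n.+1) ^+ n.+1); first by rewrite mulf_neq0 ?expf_neq0 ?invr_eq0.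
move=> x x0; rewrite NegzE opprK -exprnN -exprnP.
set y := b ^- n.+1 * x; have xE : x = b ^+ n.+1 * y by rewrite mulVKf.
have y0 : y != 0 by rewrite mulf_neq0// invr_eq0.
rewrite [in Theta b x]xE cP// -!mulrA [_ * (x ^+ _ * _)]mulrA -exprMn -/y.
by rewrite [X in _ = _ * X]mulrCA (mulKf c0) (mulVKf (expf_neq0 _ y0)).
Qed.

(** This is - x times the logarithmic derivative of (x; b)_infinity. *)
Definition log_series (x : C) : C :=
  limn (fun M => \sum_(m < M) x * b ^+ m / (1 - x * b ^+ m)).

Lemma log_series_cvg x : qpoch x b != 0 ->
  (fun M => \sum_(m < M) x * b ^+ m / (1 - x * b ^+ m)) @ \oo --> log_series x.
Proof.
move=> /(pprod_is_dlog rho01 b_rho)[l xl _].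
apply/cvg_ex; exists (x * l).
rewrite (_ : (fun M => _) = fun M => x * \sum_(m < M) b ^+ m / (1 - x * b ^+ m)).
  exact: cvgM (cvg_cst _) xl.
by apply/funext => M; rewrite mulr_sumr; apply: eq_bigr => m _; rewrite mulrA.
Qed.

Lemma qpoch_dlog x : qpoch x b != 0 -> x != 0 ->
  is_dlog (fun y => qpoch y b) x (- (log_series x / x)).
Proof.
move=> qx x0; have [l xl dl] := pprod_is_dlog rho01 b_rho qx.
suff -> : log_series x = l * x by rewrite mulfK.
apply: (cvg_lim (@norm_hausdorff _ _)); rewrite mulrC.
rewrite (_ : (fun M => _) = fun M => x * \sum_(m < M) b ^+ m / (1 - x * b ^+ m)).
  exact: cvgM (cvg_cst _) xl.
by apply/funext => M; rewrite mulr_sumr; apply: eq_bigr => m _; rewrite mulrA.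
Qed.

(* x Theta'(x) / Theta(x) *)
Definition theta_log (x : C) : C := log_series (b * x^-1) - log_series x.

Lemma Theta_dlog x : x != 0 -> Theta b x != 0 ->
  is_dlog (Theta b) x (theta_log x / x).
Proof.
move=> x0; rewrite /Theta !mulf_eq0 !negb_or => /andP[/andP[qx qbx] qb].
have bx0 : b * x^-1 != 0 by rewrite mulf_neq0// invr_eq0.
(* One summand for each factor of Theta: (x; b), then (b/x; b) with the inner derivative - b/x^2,
   then the constant (b; b). *)
rewrite (_ : theta_log x / x =
    - (log_series x / x)
    + - (log_series (b * x^-1) / (b * x^-1)) * (- (b / x ^+ 2)) + 0).
  apply: is_dlogM; last exact: is_dlog_cst.
  apply: is_dlogM; first exact: qpoch_dlog.
  apply: (is_dlog_comp (f := fun y => qpoch y b) (g := fun y => b * y^-1)).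
    exact: qpoch_dlog.
  have [_ dV] : is_dlog (fun y : C => y^-1) x (- x^-1).
    apply: is_dlogV; split=> //; rewrite mulVf//; exact: is_derive_id.
  have -> : - (b / x ^+ 2) = b * (- x^-1 / x) by field.
  apply: (is_derive_chain (f := fun y => b * y)) dV.
  rewrite -[X in is_derive _ _ _ X]mulr1.
  exact: is_deriveZ.
by rewrite /theta_log; field; rewrite x0 b_neq0.
Qed.

Lemma Theta_dlog_cexp (u : C) (s : C -> C) (d : C) : u != 0 -> Theta b u != 0 ->
  s 0 = 0 -> is_derive (0 : C) (1 : C) s d ->
  is_dlog (fun t => Theta b (u * cexp (s t))) 0 (theta_log u * d).
Proof.
move=> u0 tu s0 ds.
have -> : theta_log u * d = theta_log u / u * (u * (1 * d)) by field.
apply: (is_dlog_comp (f := Theta b) (g := fun t => u * cexp (s t))).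
  by rewrite s0 cexp0 mulr1; exact: Theta_dlog.
have H : is_derive (0 : C) (1 : C) (fun t => cexp (s t)) (1 * d).
  apply: (is_derive_chain (f := @cexp R) (g := s)) ds.
  by rewrite s0; exact: is_derive_cexp0.
by apply: is_derive_eq; rewrite /GRing.scale /=.
Qed.

Lemma Theta_neq0_shift (m : int) u : u != 0 ->
  (Theta b (b ^ m * u) != 0) = (Theta b u != 0).
Proof.
move=> u0; have [c c0 ->//] := Theta_shift m.
by rewrite !mulf_eq0 !negb_or c0 expfz_neq0.
Qed.

(** The function t -> Theta(b^m u e^t) is differentiated logarithmically at 0 in two ways: directly,
    and after quasi-periodicity, where the factor e^(-mt) contributes - m. *)
Lemma theta_log_shift (m : int) u : u != 0 -> Theta b u != 0 ->
  theta_log (b ^ m * u) = theta_log u - m%:~R.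
Proof.
move=> u0 tu; have [c c0 cP] := Theta_shift m.
have bu0 : b ^ m * u != 0 by rewrite mulf_neq0// expfz_neq0.
have tbu : Theta b (b ^ m * u) != 0 by rewrite Theta_neq0_shift.
have i0 : is_derive (0 : C) (1 : C) id 1 by exact: is_derive_id.
have := Theta_dlog_cexp bu0 tbu (erefl : id 0 = 0) i0.
rewrite mulr1; move/is_dlog_unique; apply.
rewrite (_ : (fun t => _) =
    fun t => c * u ^ (- m) * cexp ((- m%:~R) * t) * Theta b (u * cexp t)).
  have -> : theta_log u - m%:~R = 0 + - m%:~R + theta_log u * 1 by ring.
  apply: is_dlogM; last exact: (Theta_dlog_cexp u0 tu (erefl : id 0 = 0)).
  apply: is_dlogM; last exact: is_dlog_cexp.
  by apply: is_dlog_cst; rewrite mulf_neq0// expfz_neq0.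
apply/funext => t.
rewrite -[b ^ m * u * _]mulrA cP; last exact: mulf_neq0 u0 (cexp_neq0 t).
by rewrite -mulrNz cexpMz expfzMl !mulrA.
Qed.

(** * Second differences of the logarithmic derivative *)

Variable q : C.
Hypothesis q_neq0 : q != 0.

(** Each u/(1 - u) goes to - 1 - u/(1 - u) under inversion; the constants cancel because the weights
    2, -1, -1 sum to 0, and q^2 and q^-2 trade places. *)
Lemma fterm_opp (y : C) : y != 0 -> 1 - y != 0 -> 1 - y * q ^+ 2 != 0 ->
  1 - y * q ^- 2 != 0 -> fterm q y^-1 = - fterm q y.
Proof.
have geoV (u : C) : u != 0 -> 1 - u != 0 -> u^-1 / (1 - u^-1) = - 1 - u / (1 - u).
  move=> u0 u1; have -> : 1 - u^-1 = - (1 - u) / u by field.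
  by field; rewrite u1 u0.
move=> y0 y1 yq yq'; have q2 : q ^+ 2 != 0 by rewrite expf_neq0.
rewrite /fterm -[2 * _ / _]mulrA -[2 * y / _]mulrA.
have -> : y^-1 * q ^+ 2 = (y * q ^- 2)^-1 by rewrite invfM invrK.
have -> : y^-1 * q ^- 2 = (y * q ^+ 2)^-1 := esym (invfM y (q ^+ 2)).
by rewrite !geoV ?mulf_neq0 ?invr_eq0//; ring.
Qed.

Lemma fterm_series_cvg (y : C) : qpoch y b != 0 -> qpoch (y * q ^+ 2) b != 0 ->
  qpoch (y * q ^- 2) b != 0 ->
  (fun M => \sum_(l < M) fterm q (y * b ^+ l)) @ \oo -->
    2 * log_series y - log_series (y * q ^+ 2) - log_series (y * q ^- 2).
Proof.
move=> /log_series_cvg h0 /log_series_cvg h1 /log_series_cvg h2.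
rewrite (_ : (fun M => _) = fun M =>
   2 * (\sum_(m < M) y * b ^+ m / (1 - y * b ^+ m))
   - (\sum_(m < M) y * q ^+ 2 * b ^+ m / (1 - y * q ^+ 2 * b ^+ m))
   - (\sum_(m < M) y * q ^- 2 * b ^+ m / (1 - y * q ^- 2 * b ^+ m))).
  exact: cvgB (cvgB (cvgM (cvg_cst (2 : C)) h0) h1) h2.
apply/funext => M; rewrite mulr_sumr -!sumrB; apply: eq_bigr => m _.
by rewrite /fterm -[2 * _ / _]mulrA [y * q ^+ 2 * _]mulrAC [y * q ^- 2 * _]mulrAC.
Qed.

Definition theta_log2 (u : C) : C :=
  theta_log (u * q ^+ 2) + theta_log (u * q ^- 2) - 2 * theta_log u.

Definition Theta_regular (u : C) :=
  [/\ Theta b u != 0, Theta b (u * q ^+ 2) != 0 & Theta b (u * q ^- 2) != 0].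

(** The shifts - m, - m and + 2m cancel. *)
Lemma theta_log2_shift (m : int) u : u != 0 -> Theta_regular u ->
  theta_log2 (b ^ m * u) = theta_log2 u.
Proof.
move=> u0 [t0 t1 t2]; rewrite /theta_log2 -!mulrA.
by rewrite !theta_log_shift// ?mulf_neq0 ?invr_eq0 ?expf_neq0//; ring.
Qed.

Lemma Theta_qpoch u : Theta b u != 0 -> qpoch u b != 0 /\ qpoch (b * u^-1) b != 0.
Proof. by rewrite !mulf_eq0 !negb_or => /andP[/andP[]]. Qed.

(** One series comes from each of (u; b) and (b/u; b). At u = x^2 q^N one has b/u = x^-2 q^N, so for
    the odd class this difference is already the antisymmetrisation in x. *)
Lemma theta_log2_half u : u != 0 -> Theta_regular u ->
  exists f1 f2 : C,
  [/\ (fun M => \sum_(l < M) fterm q (u * b ^+ l)) @ \oo --> f1,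
      (fun M => \sum_(l < M) fterm q (b * u^-1 * b ^+ l)) @ \oo --> f2 &
      theta_log2 u = f1 - f2].
Proof.
move=> u0 [/Theta_qpoch[t0 t0'] /Theta_qpoch[t1 t1'] /Theta_qpoch[t2 t2']].
have E1 : b * (u * q ^+ 2)^-1 = b * u^-1 * q ^- 2 by rewrite (invfM u) mulrA.
have E2 : b * (u * q ^- 2)^-1 = b * u^-1 * q ^+ 2 by rewrite (invfM u) invrK mulrA.
move: t1' t2'; rewrite E1 E2 => t1' t2'.
do 2 eexists; split; [exact: fterm_series_cvg|exact: fterm_series_cvg|].
by rewrite /theta_log2 /theta_log E1 E2; ring.
Qed.

(** For the series in u^-1 to start at l = 0, the term [fterm q u^-1] is added to the second series
    and compensated. Since [fterm] is odd under inversion, the compensation splits evenly between u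
    and u^-1: this is the origin of the -1/2 terms of f_h. *)
Lemma theta_log2_bracket u : u != 0 -> Theta_regular u ->
  exists f1 f2 : C,
  [/\ (fun M => \sum_(l < M) fterm q (u * b ^+ l)) @ \oo --> f1,
      (fun M => \sum_(l < M) fterm q (u^-1 * b ^+ l)) @ \oo --> f2 &
      theta_log2 u = (f1 - 2^-1 * fterm q u) - (f2 - 2^-1 * fterm q u^-1)].
Proof.
move=> u0 ur; have [f1 [f2 [h1 h2 uE]]] := theta_log2_half u0 ur.
have [/Theta_qpoch[t0 _] /Theta_qpoch[t1 _] /Theta_qpoch[t2 _]] := ur.
have {}t0 : 1 - u != 0 by move: t0; rewrite qpochS mulf_eq0 negb_or => /andP[].
have {}t1 : 1 - u * q ^+ 2 != 0.
  by move: t1; rewrite qpochS mulf_eq0 negb_or => /andP[].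
have {}t2 : 1 - u * q ^- 2 != 0.
  by move: t2; rewrite qpochS mulf_eq0 negb_or => /andP[].
exists f1, (f2 + fterm q u^-1); split; [exact: h1| |by rewrite uE fterm_opp//; field].
rewrite -cvg_shiftS (_ : [sequence _]_n = fun n =>
    (\sum_(l < n) fterm q (b * u^-1 * b ^+ l)) + fterm q u^-1).
  exact: cvgD h2 (cvg_cst _).
apply/funext => n; rewrite /= big_ord_recl expr0 mulr1 addrC; congr (_ + _).
by apply: eq_bigr => l _; rewrite lift0 exprS mulrA [u^-1 * b]mulrC.
Qed.

Lemma scaled_sumE (e : C) (F : nat -> C) :
  (fun M => \sum_(l < M) e * F l) = fun M => e * \sum_(l < M) F l.
Proof. by apply/funext => M; rewrite mulr_sumr. Qed.

(** A parity class of k can be empty, and then no theta function at u is known to be nonzero. Its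
    coefficient [e] is 0 in that case, and all the terms are 0. *)
Lemma theta_log2_bracket_scaled (e u : C) : u != 0 ->
  (e != 0 -> Theta_regular u) -> exists f1 f2 : C,
  [/\ (fun M => \sum_(l < M) e * fterm q (u * b ^+ l)) @ \oo --> f1,
      (fun M => \sum_(l < M) e * fterm q (u^-1 * b ^+ l)) @ \oo --> f2 &
      e * theta_log2 u =
        (f1 - 2^-1 * e * fterm q u) - (f2 - 2^-1 * e * fterm q u^-1)].
Proof.
move=> u0; rewrite (scaled_sumE _ (fun l => fterm q (u * b ^+ l))).
rewrite (scaled_sumE _ (fun l => fterm q (u^-1 * b ^+ l))).
have [->|e0 /(_ isT) ur] := eqVneq e 0.
  exists 0, 0; split; last by rewrite !(mul0r, mulr0, subrr).
    by under eq_fun do rewrite mul0r; exact: cvg_cst.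
  by under eq_fun do rewrite mul0r; exact: cvg_cst.
have [f1 [f2 [h1 h2 ->]]] := theta_log2_bracket u0 ur.
exists (e * f1), (e * f2).
split; [exact: cvgM (cvg_cst e) h1|exact: cvgM (cvg_cst e) h2|ring].
Qed.

Lemma theta_log2_half_scaled (e u : C) : u != 0 ->
  (e != 0 -> Theta_regular u) -> exists f1 f2 : C,
  [/\ (fun M => \sum_(l < M) e * fterm q (u * b ^+ l)) @ \oo --> f1,
      (fun M => \sum_(l < M) e * fterm q (b * u^-1 * b ^+ l)) @ \oo --> f2 &
      e * theta_log2 u = f1 - f2].
Proof.
move=> u0; rewrite (scaled_sumE _ (fun l => fterm q (u * b ^+ l))).
rewrite (scaled_sumE _ (fun l => fterm q (b * u^-1 * b ^+ l))).
have [->|e0 /(_ isT) ur] := eqVneq e 0.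
  exists 0, 0; split; last by rewrite mul0r subrr.
    by under eq_fun do rewrite mul0r; exact: cvg_cst.
  by under eq_fun do rewrite mul0r; exact: cvg_cst.
have [f1 [f2 [h1 h2 ->]]] := theta_log2_half u0 ur.
exists (e * f1), (e * f2).
split; [exact: cvgM (cvg_cst e) h1|exact: cvgM (cvg_cst e) h2|ring].
Qed.

End Theta.

(** * Sums over the range of k *)

Section RangeSums.

Lemma sum_even_iota m :
  (\sum_(k <- iota 0 m.+1 | ~~ odd k) k = m./2 * m./2.+1)%N.
Proof.
elim: m => [|m IHm]; first by rewrite big_cons big_nil.
rewrite -addn1 iotaD big_cat /= IHm big_cons big_nil add0n.
have := odd_double_half m; rewrite /= !uphalf_half.
by case: (odd m) => /=; move: (m./2) => j; nia.
Qed.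

Lemma sum_odd_iota m :
  (\sum_(k <- iota 0 m.+1 | odd k) k = uphalf m ^ 2)%N.
Proof.
elim: m => [|m IHm]; first by rewrite big_cons big_nil.
rewrite -addn1 iotaD big_cat /= IHm big_cons big_nil add0n.
have := odd_double_half m; rewrite /= !uphalf_half.
by case: (odd m) => /=; move: (m./2) => j; nia.
Qed.

(** The range for n >= 0 may be started at k = 0, which adds nothing to the sum; both signs of n
    then reduce to an initial segment. *)
Lemma big_krange (P : pred nat) (n : int) :
  (\sum_(k <- krange n | P k) k =
   \sum_(k <- iota 0 (if n is Negz m then m else `|n|).+1 | P k) k)%N.
Proof.
case: n => // m; rewrite [in RHS]/= [in RHS]big_cons.
by case: ifP.
Qed.

Lemma sum_even_krange (n : int) :
  (\sum_(k <- krange n | ~~ odd k) k)%N = (n %/ 2)%Z * ((n %/ 2)%Z + 1) :> int.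
Proof.
rewrite big_krange sum_even_iota PoszM -addn1 PoszD; case: n => m.
  by have -> : (Posz m %/ 2)%Z = m./2 by lia.
(* For n < 0 the floor is - 1 - j with j the half of m, and e(e + 1) is invariant under e -> - 1 -
   e. *)
have -> : (Negz m %/ 2)%Z = - (m./2.+1%:Z) by lia.
by rewrite -addn1 PoszD; ring.
Qed.

Lemma sum_odd_krange (n : int) :
  (\sum_(k <- krange n | odd k) k)%N = ((n + 1) %/ 2)%Z ^+ 2 :> int.
Proof.
rewrite big_krange sum_odd_iota -mulnn PoszM; case: n => m.
  by have -> : ((Posz m + 1) %/ 2)%Z = uphalf m by lia.
have -> : ((Negz m + 1) %/ 2)%Z = - (uphalf m)%:Z by lia.
by rewrite expr2 mulrNN.
Qed.

Lemma sum_krange (n : int) :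
  2 * Posz (\sum_(k <- krange n) k)%N = n * (n + 1) :> int.
Proof.
rewrite (bigID odd) /= PoszD sum_even_krange sum_odd_krange.
have : n = 2 * (n %/ 2)%Z /\ ((n + 1) %/ 2)%Z = (n %/ 2)%Z \/
    n = 2 * (n %/ 2)%Z + 1 /\ ((n + 1) %/ 2)%Z = (n %/ 2)%Z + 1 by lia.
move: (n %/ 2)%Z ((n + 1) %/ 2)%Z => a c.
by case=> [[-> ->]|[-> ->]]; ring.
Qed.

End RangeSums.

(** * The structure function near beta = 0 *)

Section StructureFunctionDlog.
Variable R : realType.
Local Notation C := R[i].
Variables (N : nat) (zeta : C) (h : int).
Hypotheses (N_gt0 : (0 < N)%N) (q_lt1 : `|e_ipi zeta| < 1).

Local Notation q := (e_ipi zeta).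
Local Notation b := (q ^+ (2 * N)).
Local Notation lam := (i_pi R * zeta * N%:R * h%:~R).
Local Notation p beta := (e_ipi (2 * tau_h N zeta h beta)).
Local Notation P k := (q ^ (N%:Z * h * k)).

Lemma e_ipi_neq0 (x : C) : e_ipi x != 0.
Proof. exact: cexp_neq0. Qed.

Let q0 : q != 0 := e_ipi_neq0 zeta.
Let b0 : b != 0 := expf_neq0 (2 * N) q0.
Let P0 k : P k != 0 := expfz_neq0 (N%:Z * h * k) q0.

Let b_lt1 : `|b| < 1.
Proof. by rewrite normrX exprn_ilt1// muln_eq0 -lt0n. Qed.

(** The part of ln p that vanishes at beta = 0: p = q^(Nh) exp ([nome_shift] beta). *)
Let nome_shift (beta : C) : C := lam * ((1 - beta)^-1 - 1).

Lemma nome_expz (beta : C) (k : int) :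
  p beta ^ k = P k * cexp (k%:~R * nome_shift beta).
Proof.
rewrite /e_ipi -!cexpMz -cexpD; congr cexp.
rewrite /nome_shift /tau_h invfM !rmorphM /=.
by move: (1 - beta)^-1 => v; field.
Qed.

Lemma nome_shift0 : nome_shift 0 = 0.
Proof. by rewrite /nome_shift subr0 invr1 subrr mulr0. Qed.

Lemma is_derive_nome_shift : is_derive (0 : C) (1 : C) nome_shift lam.
Proof.
have [_ dV] : is_dlog (fun y : C => (1 - y)^-1) 0 1.
  rewrite -[X in is_dlog _ _ X]opprK; apply: is_dlogV.
  split; first by rewrite subr0 oner_neq0.
  by rewrite subr0 mulr1; apply: is_derive_eq; rewrite sub0r.
by apply: is_derive_eq; rewrite /GRing.scale /= !subr0 invr1 !mulr1.
Qed.

Lemma Theta_nome_dlog (y : C) (k : int) : y != 0 -> Theta b (y * P k) != 0 ->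
  is_dlog (fun beta => Theta b (y * p beta ^ k)) 0
    (theta_log b (y * P k) * (k%:~R * lam)).
Proof.
move=> y0 ty.
rewrite (_ : (fun beta => _) =
    fun beta => Theta b (y * P k * cexp (k%:~R * nome_shift beta))).
  apply: (Theta_dlog_cexp b_lt1 b0 _ ty (s := fun beta => k%:~R * nome_shift beta)).
  - exact: mulf_neq0 y0 (P0 k).
  - by rewrite nome_shift0 mulr0.
  - have ds := is_derive_nome_shift.
    by apply: is_derive_eq.
by apply/funext => beta; rewrite nome_expz mulrA.
Qed.

(** The factor of Y_N for one k, with u and v standing for p^k and p^-k. *)
Let Ytheta (y : C) (u : C) (v : C) : C :=
  (Theta b (y * v) ^+ 2 * Theta b (y * q ^+ 2 * u) * Theta b (y * q ^- 2 * u))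
  / (Theta b (y * u) ^+ 2 * Theta b (y * q ^+ 2 * v) * Theta b (y * q ^- 2 * v)).

(** The sign from p^-k and the sign from the denominator conspire: the plain theta functions enter
    with weight -2 and the shifted ones with +1, at both p^k and p^-k, which makes two second
    differences. *)
Lemma Ytheta_dlog (y : C) (k : nat) : y != 0 ->
  Theta_regular b q (y * P k) -> Theta_regular b q (y * P (- k%:Z)) ->
  is_dlog (fun beta => Ytheta y (p beta ^ k) (p beta ^ (- k%:Z))) 0
    (k%:R * lam *
      (theta_log2 b q (y * P k) + theta_log2 b q (y * P (- k%:Z)))).
Proof.
move=> y0 [r0 r1 r2] [r0' r1' r2'].
have q20 : q ^+ 2 != 0 by rewrite expf_neq0.
have yq0 : y * q ^+ 2 != 0 by rewrite mulf_neq0.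
have yq0' : y * q ^- 2 != 0 by rewrite mulf_neq0// invr_eq0.
rewrite mulrAC in r1; rewrite mulrAC in r2.
rewrite mulrAC in r1'; rewrite mulrAC in r2'.
have := is_dlogM (is_dlogM (is_dlogM (is_dlogM
   (Theta_nome_dlog y0 r0') (Theta_nome_dlog y0 r0'))
   (Theta_nome_dlog yq0 r1)) (Theta_nome_dlog yq0' r2))
  (is_dlogV (is_dlogM (is_dlogM (is_dlogM
   (Theta_nome_dlog y0 r0) (Theta_nome_dlog y0 r0))
   (Theta_nome_dlog yq0 r1')) (Theta_nome_dlog yq0' r2'))).
rewrite (_ : _ + _ = k%:R * lam *
      (theta_log2 b q (y * P k) + theta_log2 b q (y * P (- k%:Z)))); first exact.
rewrite /theta_log2 ![y * P _ * _]mulrAC rmorphN /= -pmulrn.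
ring.
Qed.

(** At beta = 0 the arguments with p^k and p^-k differ by q^(2Nhk) = b^(hk). Quasi-periodicity
    reduces all of them to p^-k, and the multipliers cancel since the shifts by q^2 and q^-2 are
    balanced by the square. *)
Lemma Ytheta_eq1 (y : C) (k : nat) : y != 0 ->
  Theta_regular b q (y * P k) -> Theta_regular b q (y * P (- k%:Z)) ->
  Ytheta y (P k) (P (- k%:Z)) = 1.
Proof.
move=> y0 [r0 r1 r2] [r0' r1' r2'].
have q20 : q ^+ 2 != 0 by rewrite expf_neq0.
rewrite mulrAC in r1; rewrite mulrAC in r2.
rewrite mulrAC in r1'; rewrite mulrAC in r2'.
have [c c0 cP] := Theta_shift b_lt1 b0 (h * k).
have PE u : u * P k = b ^ (h * k) * (u * P (- k%:Z)).
  rewrite [RHS]mulrCA; congr (_ * _).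
  by rewrite [b]exprnP exprz_exp -expfzDr//; congr (_ ^ _); rewrite PoszM; ring.
have cPk u : u != 0 -> Theta b (u * P k) =
    c * (u * P (- k%:Z)) ^ (- (h * k)) * Theta b (u * P (- k%:Z)).
  by move=> u0; rewrite PE cP//; exact: mulf_neq0 u0 (P0 _).
have yq0 := mulf_neq0 y0 q20.
have yq0' : y * q ^- 2 != 0 by apply: mulf_neq0 y0 _; rewrite invr_eq0.
rewrite /Ytheta (cPk _ y0) (cPk _ yq0) (cPk _ yq0').
(* A, B, D are the theta values at p^-k, and w, v, Q are y, q^2, p^-k. Making their m-th powers
   opaque leaves a rational identity. *)
have ratio (A B D w v Q : C) (m : int) :
    A != 0 -> B != 0 -> D != 0 -> w != 0 -> v != 0 -> Q != 0 ->
    A ^+ 2 * (c * (w * v * Q) ^ m * B) * (c * (w * v^-1 * Q) ^ m * D)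
    / ((c * (w * Q) ^ m * A) ^+ 2 * B * D) = 1.
  move=> A0 B0 D0 w0 v0 Q0; rewrite !expfzMl -expfV.
  have wm0 := expfz_neq0 m w0; have vm0 := expfz_neq0 m v0; have Qm0 := expfz_neq0 m Q0.
  move: (w ^ m) (v ^ m) (Q ^ m) wm0 vm0 Qm0 => wm vm Qm wm0 vm0 Qm0.
  by field; rewrite c0 A0 B0 D0 wm0 vm0 Qm0.
exact: ratio r0' r1' r2' y0 q20 (P0 _).
Qed.

Lemma nome_parity (e : int) :
  exists m : int, q ^ (N%:Z * e) = b ^ m * (if odd `|e| then q ^+ N else 1).
Proof.
exists (e %/ 2)%Z.
have {1}-> : e = 2 * (e %/ 2)%Z + odd `|e| by lia.
rewrite mulrDr expfzDr// [b]exprnP exprz_exp; congr (_ ^ _ * _).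
  by rewrite PoszM; ring.
by case: odd; rewrite ?mulr1 ?mulr0.
Qed.

Lemma Theta_regular_parity (y : C) (e : int) : y != 0 ->
  Theta_regular b q (y * q ^ (N%:Z * e)) ->
  Theta_regular b q (if odd `|e| then y * q ^+ N else y) /\
  theta_log2 b q (y * q ^ (N%:Z * e)) =
    theta_log2 b q (if odd `|e| then y * q ^+ N else y).
Proof.
move=> y0; have [m ->] := nome_parity e; set u := if _ then y * _ else _.
have -> : y * (b ^ m * (if odd `|e| then q ^+ N else 1)) = b ^ m * u.
  by rewrite mulrCA /u; case: odd; rewrite ?mulr1.
have u0 : u != 0 by rewrite /u; case: odd; rewrite ?mulf_neq0 ?expf_neq0.
have q20 : q ^+ 2 != 0 by rewrite expf_neq0.
have q20' : q ^- 2 != 0 by rewrite invr_eq0.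
move=> [r0 r1 r2].
have ur : Theta_regular b q u.
  split; first by rewrite -(Theta_neq0_shift b_lt1 b0 m u0).
    by rewrite -(Theta_neq0_shift b_lt1 b0 m (mulf_neq0 u0 q20)) mulrA.
  by rewrite -(Theta_neq0_shift b_lt1 b0 m (mulf_neq0 u0 q20')) mulrA.
by split; rewrite ?theta_log2_shift.
Qed.

(** * One factor of the structure function *)

Section OneFactor.
Variables (n : int) (xi : C).
Hypothesis xi_reg : Yregular N zeta (tau_h N zeta h 0) n xi.

Local Notation y := (e_ipi (2 * xi)).

Let y0 : y != 0 := e_ipi_neq0 (2 * xi).

Lemma nome0 (k : int) : p 0 ^ k = P k.
Proof. by rewrite nome_expz nome_shift0 mulr0 cexp0 mulr1. Qed.

Lemma Yregular_Theta k : k \in krange n ->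
  Theta_regular b q (y * P k) /\ Theta_regular b q (y * P (- k%:Z)).
Proof.
move=> kn.
have H u : u \in [:: y; y * q ^+ 2; y * q ^- 2] ->
    Theta b (u * P k) != 0 /\ Theta b (u * P (- k%:Z)) != 0.
  by move=> /(xi_reg kn); rewrite -!nome0 -exprnN -exprnP.
have [H0 H0'] := H y ltac:(by rewrite !inE eqxx).
have [H1 H1'] := H (y * q ^+ 2) ltac:(by rewrite !inE eqxx orbT).
have [H2 H2'] := H (y * q ^- 2) ltac:(by rewrite !inE eqxx !orbT).
rewrite mulrAC in H1; rewrite mulrAC in H1'.
rewrite mulrAC in H2; rewrite mulrAC in H2'.
by split; split; assumption.
Qed.

(** The representative, modulo powers of b, of both x^2 q^(Nhk) and x^2 q^(-Nhk), as hk and - hk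
    have the same parity. *)
Let red (k : nat) : C := if odd (`|h| * k) then y * q ^+ N else y.

Lemma Theta_regular_red k : k \in krange n ->
  [/\ Theta_regular b q (red k), theta_log2 b q (y * P k) = theta_log2 b q (red k)
    & theta_log2 b q (y * P (- k%:Z)) = theta_log2 b q (red k)].
Proof.
have PE (e : int) : P e = q ^ (N%:Z * (h * e)) by rewrite mulrA.
move=> kn; have := Yregular_Theta kn; rewrite !PE => -[r1 r2].
have := Theta_regular_parity y0 r1; have := Theta_regular_parity y0 r2.
rewrite !abszM abszN -/(red k) => -[_ E2] [r E1].
by split; assumption.
Qed.

Lemma Yfun_dlog :
  is_dlog (fun beta => Yfun N zeta (tau_h N zeta h beta) n xi) 0
    (\sum_(k <- krange n) k%:R * lam * (2 * theta_log2 b q (red k))).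
Proof.
rewrite /Yfun; apply: is_dlog_prod => k kn.
have [r1 r2] := Yregular_Theta kn; have [_ E1 E2] := Theta_regular_red kn.
have D := Ytheta_dlog y0 r1 r2; rewrite {}E1 {}E2 in D.
have FE : (fun beta => Ytheta y (p beta ^ k) (p beta ^ (- k%:Z))) =
    fun beta => Ytheta y (p beta ^+ k) (p beta ^- k).
  by apply/funext => beta; rewrite -exprnN -exprnP.
by rewrite FE in D; rewrite [2 * theta_log2 _ _ _]mulr_natl mulr2n; exact: D.
Qed.

Lemma Yfun_nome0 : Yfun N zeta (tau_h N zeta h 0) n xi = 1.
Proof.
rewrite /Yfun big_seq big1// => k kn; have [r1 r2] := Yregular_Theta kn.
have := Ytheta_eq1 y0 r1 r2; rewrite -!nome0 -exprnN -exprnP; exact.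
Qed.

Lemma e_ipi_sqr (x : C) : e_ipi x ^+ 2 = e_ipi (2 * x).
Proof. by rewrite /e_ipi mulrCA -cexpMn. Qed.

(** A nonzero coefficient requires some k of the range in the class [Q], and this k supplies the
    regularity at u. *)
Lemma sum_red (Q : pred nat) (u : C) : (forall k, Q k -> red k = u) ->
  (((\sum_(k <- krange n | Q k) k)%N%:R : C) != 0 -> Theta_regular b q u) /\
  \sum_(k <- krange n | Q k) k%:R * lam * (2 * theta_log2 b q (red k))
  = 2 * lam * ((\sum_(k <- krange n | Q k) k)%N%:R * theta_log2 b q u).
Proof.
move=> redE; split.
  have [/hasP[k kn Qk] _|noQ] := boolP (has Q (krange n)).
    by have [r _ _] := Theta_regular_red kn; rewrite (redE k Qk) in r.
  by rewrite big_hasC// eqxx.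
rewrite natr_sum mulr_suml mulr_sumr; apply: eq_bigr => k Qk.
by rewrite (redE k Qk); ring.
Qed.

Lemma bracket_evenE (c : C) : (c != 0 -> Theta_regular b q y) ->
  c * theta_log2 b q y =
  c * (bracket_even N q (e_ipi xi) - bracket_even N q (e_ipi xi)^-1).
Proof.
have [->|c0 /(_ isT) yr] := eqVneq c 0; first by rewrite !mul0r.
have [f1 [f2 [h1 h2 ->]]] := theta_log2_bracket b_lt1 q0 y0 yr.
rewrite /bracket_even exprVn e_ipi_sqr.
have qE l : q ^+ (2 * N * l) = b ^+ l by rewrite exprM.
have -> : limn (fun M => \sum_(l < M) fterm q (y * q ^+ (2 * N * l))) = f1.
  apply: (cvg_lim (@norm_hausdorff _ _)).
  by under eq_fun do under eq_bigr do rewrite qE; exact: h1.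
have -> : limn (fun M => \sum_(l < M) fterm q (y^-1 * q ^+ (2 * N * l))) = f2.
  apply: (cvg_lim (@norm_hausdorff _ _)).
  by under eq_fun do under eq_bigr do rewrite qE; exact: h2.
exact: erefl.
Qed.

Lemma bracket_oddE :
  let e1 : C := (((n %/ 2)%Z) * ((n %/ 2)%Z + 1))%:~R in
  let e2 : C := (((n + 1) %/ 2)%Z ^+ 2)%:~R in
  (e1 != 0 -> Theta_regular b q y) ->
  (e2 != 0 -> Theta_regular b q (y * q ^+ N)) ->
  e1 * theta_log2 b q y + e2 * theta_log2 b q (y * q ^+ N) =
  bracket_odd N q n (e_ipi xi) - bracket_odd N q n (e_ipi xi)^-1.
Proof.
move=> e1 e2 r1 r2.
have yN0 : y * q ^+ N != 0 by rewrite mulf_neq0 ?expf_neq0.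
(* The even class needs the form with the -1/2 correction; the odd class uses the uncorrected
   one. *)
have [f1 [f2 [hf1 hf2 ->]]] := theta_log2_bracket_scaled b_lt1 q0 y0 r1.
have [g1 [g2 [hg1 hg2 ->]]] := theta_log2_half_scaled b_lt1 yN0 r2.
rewrite /bracket_odd -/e1 -/e2 exprVn e_ipi_sqr.
have qE l : q ^+ (2 * N * l) = b ^+ l by rewrite exprM.
have qE' l : q ^+ (2 * N * l + N) = q ^+ N * b ^+ l by rewrite exprD exprM mulrC.
have byE : b * (y * q ^+ N)^-1 = y^-1 * q ^+ N.
  rewrite (invfM y) mulrCA; congr (_ * _).
  by rewrite mul2n -addnn exprD mulfK// expf_neq0.
rewrite byE in hg2.
have -> : limn (fun M => \sum_(l < M) (e1 * fterm q (y * q ^+ (2 * N * l))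
     + e2 * fterm q (y * q ^+ (2 * N * l + N)))) = f1 + g1.
  apply: (cvg_lim (@norm_hausdorff _ _)).
  under eq_fun do under eq_bigr do rewrite qE qE' mulrA.
  by under eq_fun do rewrite big_split; exact: cvgD hf1 hg1.
have -> : limn (fun M => \sum_(l < M) (e1 * fterm q (y^-1 * q ^+ (2 * N * l))
     + e2 * fterm q (y^-1 * q ^+ (2 * N * l + N)))) = f2 + g2.
  apply: (cvg_lim (@norm_hausdorff _ _)).
  under eq_fun do under eq_bigr do rewrite qE qE' mulrA.
  by under eq_fun do rewrite big_split; exact: cvgD hf2 hg2.
by ring.
Qed.

(** For h odd the parity of hk is that of k, so the sum splits into two classes; for h even every k
    reduces to u = x^2. *)
Lemma f_hE :
  \sum_(k <- krange n) k%:R * lam * (2 * theta_log2 b q (red k))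
  = f_h N zeta n h (e_ipi xi).
Proof.
rewrite /f_h; case: ifPn => hodd.
  have evenE k : ~~ odd k -> red k = y by rewrite /red oddM hodd => /negPf ->.
  have oddE k : odd k -> red k = y * q ^+ N by rewrite /red oddM hodd => ->.
  have [r1 S1] := sum_red evenE; have [r2 S2] := sum_red oddE.
  rewrite (bigID odd) /= S1 S2 -mulrDr addrC.
  rewrite !pmulrn sum_even_krange sum_odd_krange in r1 r2 *.
  by rewrite bracket_oddE//; ring.
have evenE k : predT k -> red k = y by rewrite /red oddM (negPf hodd).
have [r S] := sum_red evenE.
(* The factor 2 from the two second differences turns the sum of k into n(n + 1). *)
rewrite S -sum_krange rmorphM /= -[(Posz _)%:~R]pmulrn.
by rewrite bracket_evenE//; ring.
Qed.

End OneFactor.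
End StructureFunctionDlog.

(** * The Poisson bracket *)

Lemma structure_function_dlog (R : realType) (N : nat) (zeta xi : R[i])
    (n h : int) (i j : nat) :
  (0 < N)%N -> `|e_ipi zeta| < 1 ->
  (forall (a : 'I_i) (b : 'I_j), Yregular N zeta (tau_h N zeta h 0) n
     (zeta * (halfstep R b - halfstep R a) + xi)) ->
  is_dlog (fun beta => structure_function N zeta (tau_h N zeta h beta) n i j xi) 0
    (poisson_coefficient N zeta n h i j xi)
  /\ structure_function N zeta (tau_h N zeta h 0) n i j xi = 1.
Proof.
move=> N0 q1 reg; split.
  apply: is_dlog_prod => a _; apply: is_dlog_prod => b _.
  by rewrite -(f_hE N0 q1 (reg a b)); exact: (Yfun_dlog N0 q1 (reg a b)).
rewrite /structure_function big1// => a _; rewrite big1// => b _.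
exact: (Yfun_nome0 N0 q1 (reg a b)).
Qed.

(** The commutator is (S - 1) S^-1 x y, and S tends to 1. The algebra varies with t, so the limit is
    that of the scalars given by [phi t]. *)
Lemma cvg_commutator (K : numFieldType) (A : K -> algType K)
    (phi : forall t, {linear A t -> K}) (x y : forall t, A t) (S : K -> K) (d l : K) :
  (fun t => t^-1 * (S t - 1)) @ 0^' --> d ->
  (\forall t \near 0^', x t * y t = S t *: (y t * x t)) ->
  (fun t => phi t (x t * y t)) @ 0^' --> l ->
  (fun t => t^-1 * phi t (x t * y t - y t * x t)) @ 0^' --> d * l.
Proof.
move=> Sd Sxy phil.
have t0 : \forall t \near (0 : K)^', t != 0 by exact: nbhs_dnbhs_neq.
(* S is 1 + t times its difference quotient, which converges. *)
have S1 : S @ 0^' --> (1 : K).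
  rewrite -[1]addr0 -[X in 1 + X](mul0r d).
  have : (fun t => 1 + t * (t^-1 * (S t - 1))) @ 0^' --> (1 + 0 * d : K).
    apply: cvgD; first exact: cvg_cst.
    by apply: cvgM Sd; apply: cvg_within_filter; exact: cvg_id.
  apply: cvg_trans; apply: near_eq_cvg; near=> t.
  by rewrite mulVKf ?subrKC//; near: t.
have S0 : \forall t \near (0 : K)^', S t != 0.
  have : \forall t \near (0 : K)^', `|1 - S t| < 1 by move/cvgrPdist_lt : S1; apply.
  apply: filterS => t; apply: contraTneq => ->; rewrite subr0 normr1 ltxx //.
have : (fun t => t^-1 * (S t - 1) * (S t)^-1 * phi t (x t * y t)) @ 0^'
    --> (d * 1^-1 * l : K).
  by apply: cvgM phil; apply: cvgM Sd _; apply: cvgV => //; exact: oner_neq0.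
rewrite invr1 mulr1; apply: cvg_trans; apply: near_eq_cvg; near=> t.
have St : S t != 0 by near: t.
have xyE : x t * y t = S t *: (y t * x t) by near: t.
have -> : y t * x t = (S t)^-1 *: (x t * y t) by rewrite xyE scalerA mulVf// scale1r.
have phiZ (a : K) (v : A t) : phi t (a *: v) = a * phi t v := linearZZ (phi t) a v.
have tn0 : t != 0 by near: t.
by rewrite linearB phiZ; field; rewrite tn0 St.
Unshelve. all: by end_near. Qed.

Unset Implicit Arguments.

Theorem theorem9 (R : realType) (N : nat) (hN : (2 <= N)%N) (n h : int) (hh : h != 0)
  (zeta : R[i]) (hzeta : `|e_ipi zeta| < 1)
  (gh : 'M[R[i]]_N) (gh_diag : is_diag_mx gh) (gh_sqr : gh *m gh = gmx R N)
  (i j : nat) (hi : (1 <= i <= N.-1)%N) (hj : (1 <= j <= N.-1)%N)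
  (xi xi' : R[i])
  (hreg : forall (a : 'I_i) (b : 'I_j),
     Yregular N zeta (tau_h N zeta h 0) n
       (zeta * (halfstep R b - halfstep R a) + (xi' - xi))) :
  (* the structure function is 1 + beta * poisson_coefficient + o(beta) *)
  (structure_function N zeta (tau_h N zeta h 0) n i j (xi' - xi) = 1 /\
   (fun beta : R[i] =>
      beta^-1 * (structure_function N zeta (tau_h N zeta h beta) n i j (xi' - xi) - 1))
     @ 0^' --> poisson_coefficient N zeta n h i j (xi' - xi)) /\
  (* hence the limit of the commutators *)
  forall (c : R[i] -> R[i]) (A : R[i] -> algType R[i])
    (L Lminv : forall beta : R[i], R[i] -> 'M[A beta]_N)
    (K : Type) (corr : forall beta : R[i], K -> {linear A beta -> R[i]})
    (wi wj : forall beta : R[i], A beta)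
    (* the surface Sigma_{N,n} *)
    (hsurf : \forall beta \near (0 : R[i]),
       (- e_ipi (tau_h N zeta h beta)) ^ n = e_ipi (zeta * (- c beta - N%:R)))
    (halg : \forall beta \near (0 : R[i]),
       Aqp_sl gh zeta (tau_h N zeta h beta) (c beta) (L beta) (Lminv beta))
    (hsep : \forall beta \near (0 : R[i]),
       forall y : A beta, (forall k, corr beta k y = 0) -> y = 0)
    (hwi : \forall beta \near (0 : R[i]),
       is_w gh zeta (tau_h N zeta h beta) (c beta) (L beta) (Lminv beta)
         (corr beta) n i xi (wi beta))
    (hwj : \forall beta \near (0 : R[i]),
       is_w gh zeta (tau_h N zeta h beta) (c beta) (L beta) (Lminv beta)
         (corr beta) n j xi' (wj beta))
    (* the exchange relation of the operators w on Sigma_{N,n} *)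
    (hexch : \forall beta \near (0 : R[i])^',
       wi beta * wj beta
       = structure_function N zeta (tau_h N zeta h beta) n i j (xi' - xi)
         *: (wj beta * wi beta))
    (* regularity of the products at beta = 0 *)
    (hcont : forall k : K,
       (fun beta => corr beta k (wi beta * wj beta)) @ 0^'
         --> corr 0 k (wi 0 * wj 0)),
    forall k : K,
      (fun beta => beta^-1 * corr beta k (wi beta * wj beta - wj beta * wi beta)) @ 0^'
        --> corr 0 k (poisson_coefficient N zeta n h i j (xi' - xi) *: (wi 0 * wj 0)).
Proof.
have [SD S1] := structure_function_dlog (ltnW hN) hzeta hreg.
have dS := is_dlog_cvg SD S1; split; first by split; [exact: S1|exact: dS].
move=> c A L Lminv K corr wi wj _ _ _ _ _ hexch hcont k.
have -> : corr 0 k (poisson_coefficient N zeta n h i j (xi' - xi) *: (wi 0 * wj 0)) =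
    poisson_coefficient N zeta n h i j (xi' - xi) * corr 0 k (wi 0 * wj 0).
  exact: (linearZZ (corr 0 k)).
exact: (cvg_commutator (phi := fun beta => corr beta k) dS hexch (hcont k)).
Qed.
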